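(* Let $\alpha\in(0,1)$, $\mu=1-\alpha$, $\rho=\alpha/\mu<1$, $\eta=\rho/(1-\rho)$. Let $\{Q_n\}$ be the reflected random walk on $\{0,1,2,\dots\}$, $$Q_{n+1}=\max(0,Q_n+D_{n+1}),\qquad n\ge0,$$ where $\{D_n\}$ is i.i.d. with $\mathsf P\{D_n=1\}=\alpha$ and $\mathsf P\{D_n=-1\}=\mu$, and let $\{W_n\}$ be i.i.d. $N(0,1)$, independent of $\{Q_n\}$. Consider the scalar recursion $$\theta_{n+1}=\theta_n+\tfrac1{n+1}\bigl\{(Q_{n+1}-\eta-1)\theta_n+W_{n+1}\bigr\},\qquad\theta_0\in\mathbb R .$$ Then: (i) For all $\rho<1$, $\lim_{n\to\infty}\theta_n=\theta^*=0$ almost surely. (ii) If $\rho>1/2$, then $\lim_{n\to\infty}\mathsf E[\theta_n^2]=\infty$.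
   Context: The initial conditions $\theta_0\in\mathbb R$ and $Q_0\in\{0,1,2,\dots\}$ are deterministic and arbitrary. For $\rho<1$ the chain $\{Q_n\}$ has a geometric invariant measure $\pi$ with mean $\eta=\mathsf E_\pi[Q_n]=\rho/(1-\rho)$. *)

(* Defs.v *)
From HB Require Import structures.
From mathcomp Require Import all_boot all_order all_algebra.
From mathcomp Require Import all_classical all_reals all_analysis.
Set Implicit Arguments.
Unset Strict Implicit.
Unset Printing Implicit Defensive.
Import Order.TTheory GRing.Theory Num.Theory.
Import numFieldNormedType.Exports.
Local Open Scope classical_set_scope.
Local Open Scope ring_scope.

Section independence.
Context {d : measure_display} {T : measurableType d} {R : realType}.
Variable P : probability T R.

Definition mutually_independent (X : nat -> {RV P >-> R}) : Prop :=
  forall (s : seq nat) (B : nat -> set R), uniq s ->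
    (forall i, i \in s -> measurable (B i)) ->
    P (\bigcap_(i in [set` s]) (X i @^-1` B i)) =
    (\prod_(i <- s) P (X i @^-1` B i))%E.

Definition identically_distributed (X : nat -> {RV P >-> R}) : Prop :=
  forall (i j : nat) (B : set R), measurable B ->
    distribution P (X i) B = distribution P (X j) B.

Definition iid (X : nat -> {RV P >-> R}) : Prop :=
  mutually_independent X /\ identically_distributed X.

Definition sigma_process (X : nat -> {RV P >-> R}) : set (set T) :=
  <<s \bigcup_n preimage_set_system setT (X n) measurable >>.

Definition independent_processes (X Y : nat -> {RV P >-> R}) : Prop :=
  forall A B : set T, sigma_process X A -> sigma_process Y B ->
    P (A `&` B) = (P A * P B)%E.

End independence.

(* Main.v *)
Require Import Defs.
From HB Require Import structures.
From mathcomp Require Import all_boot all_order all_algebra.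
From mathcomp Require Import all_classical all_reals all_analysis.
From mathcomp Require Import measurable_realfun.
From mathcomp Require Import ring lra.
Set Implicit Arguments.
Unset Strict Implicit.
Unset Printing Implicit Defensive.
Import Order.TTheory GRing.Theory Num.Theory.
Import numFieldNormedType.Exports.
Local Open Scope classical_set_scope.
Local Open Scope ring_scope.

(** The noise is first absorbed into its running mean.  Let s_n be the mean of
    the first n noise variables; since s_(n+1) = s_n + (W_(n+1) - s_n) / (n+1),
    the difference y = theta - s satisfies
<<
      y_(n+1) = (1 + (Q_(n+1) - eta - 1) / (n+1)) y_n
                + (Q_(n+1) - eta) s_n / (n+1),
>>
    in which no fresh noise appears.  Almost sure convergence is therefore a
    pathwise fact ([recursion_cvg0]) about paths for which both s_n and
    c_n = (1/n) (Q_1 + ... + Q_n) - eta tend to 0.  Because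
    (Q_(n+1) - eta) / (n+1) = c_(n+1) - c_n + c_n / (n+1), the multiplier is at
    most exp (c_(n+1) - c_n) exp ((c_n - 1) / (n+1)), so that |y_n| exp (- c_n)
    contracts by a factor close to 1 - 1/(n+1); these factors multiply to 0
    since the harmonic series diverges.

    Both averages are controlled by one law of large numbers, for uncorrelated
    sequences with bounded second moments ([slln_uncorrelated]).  For the noise,
    correlations vanish because (W_i, W_j) and (W_i, - W_j) have the same law
    ([dot_symmetric]).  For the queue, the exact identity
<<
      Q_(n+1) (Q_(n+1) + 1) = Q_n (Q_n + 1) + (2 Q_n + 1) D_(n+1) + 1
>>
    ([qlen_identity]) replaces ergodic theory: after summation it expresses the
    average of 2 Q + 1 through the uncorrelated variables
    (2 Q_n + 1) (D_(n+1) - E D) and the boundary term Q_n (Q_n + 1) / n.  The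
    fourth moment of Q_n is bounded, because an exponential moment contracts
    ([qlen_exp_bounded]), and this makes the boundary term negligible.

    Divergence of the second moment comes from the single event that the queue
    increases during the first n steps.  It has probability alpha ^ n and is
    independent of the noise.  On it theta follows a linear recursion with
    deterministic multipliers tending to 2, whose second moment eventually grows
    by a factor at least (7/4) ^ 2 = 49/16 at each step.  Since rho > 1/2 means
    alpha > 1/3, the product alpha * 49/16 exceeds 1 ([second_moment_blowup]). *)

(** * A random linear recursion with gain 1/n *)

Section deterministic.
Context {R : realType}.

Lemma expRN_le (x : R) : 0 <= x -> expR (- x) <= (1 + x)^-1.
Proof.
move=> x0; rewrite expRN lef_pV2 ?posrE ?expR_gt0 ?expR_ge1Dx//.
by rewrite ltr_wpDr.
Qed.

Lemma harmonic_sum_cvgy : series (@harmonic R) n @[n --> \oo] --> +oo.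
Proof.
apply: nondecreasing_dvgn_lt; last exact: dvg_harmonic.
by apply: nondecreasing_series => n _ _; exact: harmonic_ge0.
Qed.

(** The products of the factors 1 - b / (n+1) are at most exp (- b H_n), where H_n
    is the n-th harmonic sum.  The sign of [U] is not constrained: a nonpositive
    value stays nonpositive, which is why only an upper bound is concluded. *)
Lemma harmonic_contraction (b : R) (U : nat -> R) : 0 < b ->
  (\forall n \near \oo, U n.+1 <= (1 - b / n.+1%:R) * U n) ->
  forall e, 0 < e -> \forall n \near \oo, U n <= e.
Proof.
move=> b0 Udecr e e0.
have b1 : \forall n \near \oo, b / n.+1%:R <= 1.
  near=> n; rewrite ler_pdivrMr// mul1r.
  rewrite (@le_trans _ _ n%:R)//; last by rewrite ler_nat.
  near: n; exact: nbhs_infty_ger.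
have [N _ HN] : \forall n \near \oo,
    U n.+1 <= (1 - b / n.+1%:R) * U n /\ b / n.+1%:R <= 1.
  by near=> n; split; near: n.
pose H := series (@harmonic R).
(* Undoes the decay accumulated up to [N], so that the bound starts exactly. *)
pose A := Num.max (U N) 0 * expR (b * H N).
have A0 : 0 <= A by rewrite mulr_ge0 ?expR_ge0// le_max lexx orbT.
have UA n : (N <= n)%N -> U n <= A * expR (- (b * H n)).
  elim: n => [|n IH].
    rewrite leqn0 => /eqP N0; rewrite /A N0 -mulrA -expRD subrr expR0 mulr1.
    by rewrite le_max lexx.
  rewrite leq_eqVlt => /predU1P[<-|].
    by rewrite /A -mulrA -expRD subrr expR0 mulr1 le_max lexx.
  rewrite ltnS => Nn; have [h1 h2] := HN n Nn.
  apply: (le_trans h1); apply: (@le_trans _ _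
    ((1 - b / n.+1%:R) * (A * expR (- (b * H n))))).
    by rewrite ler_wpM2l ?IH// subr_ge0.
  rewrite mulrCA ler_wpM2l//.
  have -> : H n.+1 = H n + n.+1%:R^-1 by rewrite /H seriesSr.
  rewrite mulrDr opprD expRD mulrC ler_wpM2l ?expR_ge0//.
  by rewrite -mulNr (le_trans _ (expR_ge1Dx _))// mulNr.
have cv : A * expR (- (b * H n)) @[n --> \oo] --> 0.
  rewrite -[X in _ --> X](mulr0 A); apply: cvgM; first exact: cvg_cst.
  apply: (cvg_comp H (fun x => expR (- (b * x)))).
    exact: harmonic_sum_cvgy.
  apply: (cvg_comp ( *%R b) (fun x => expR (- x))); last exact: cvgr_expR.
  by apply: gt0_cvgMry => //; exact: cvg_id.
near=> n; apply: (le_trans (UA n _)).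
  by near: n; exact: nbhs_infty_ge.
rewrite (le_trans (ler_norm _))//.
near: n.
by apply: cvgr0_norm_le.
Unshelve. all: by end_near. Qed.

(** One step of the Lyapunov function |y| exp (- c) - 2 e c - K e, with [A] the
    gain 1/(n+1), [C] and [C'] two consecutive values of c, and [Q] the new queue
    length.  The factor exp (- c) turns the increment C' - C hidden in the
    multiplier into a telescoping term; the correction - 2 e c does the same for
    the forcing A (Q + eta) e, which has no useful bound by itself, the 2 being a
    bound for exp (- C'); and the constant K makes - K A / 2 dominate what is left. *)
Lemma lyapunov_step (eta e A Q C C' Y Y' S K : R) : K = 8 * eta + 5 ->
  0 <= eta -> 0 < e -> 0 < A -> A <= 2^-1 -> A * (eta + 1) <= 1 ->
  0 <= Q -> `|C| <= 4^-1 -> `|C'| <= 4^-1 -> `|S| <= e ->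
  A * (Q - eta) = C' - C + A * C ->
  Y' = (1 + A * (Q - eta - 1)) * Y + A * (Q - eta) * S ->
  `|Y'| * expR (- C') - 2 * e * C' - K * e <=
    (1 - 2^-1 * A) * (`|Y| * expR (- C) - 2 * e * C - K * e).
Proof.
move=> KE eta0 e0 A0 A2 Aeta Q0.
rewrite [`|C| <= _]ler_norml [`|C'| <= _]ler_norml.
move=> /andP[cl cu] /andP[cl' cu'] Se qcE ->.
pose k := 2 * eta + 1.
have AQ : 0 <= A * Q by rewrite mulr_ge0// ltW.
have Aeta0 : 0 <= A * eta by rewrite mulr_ge0// ltW.
have AC : 0 <= A * (4^-1 - C) by rewrite mulr_ge0; lra.
have M0 : 0 <= 1 + A * (Q - eta - 1) by lra.
have f0 : 0 <= A * (Q + eta) by lra.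
set Y1 := `|_ + _|.
have Y1le : Y1 <= (1 + A * (Q - eta - 1)) * `|Y| + A * (Q + eta) * e.
  rewrite /Y1 (le_trans (ler_normD _ _))// normrM (ger0_norm M0).
  rewrite lerD2l normrM ler_pM// normrM (gtr0_norm A0) (ler_wpM2l (ltW A0))//.
  by rewrite ler_norml; apply/andP; split; lra.
have fE : A * (Q + eta) <= C' - C + A * k.
  have -> : A * (Q + eta) = A * (Q - eta) + 2 * eta * A by ring.
  by rewrite qcE /k; lra.
have MM : (1 + A * (Q - eta - 1)) * expR (- C') <= (1 - 2^-1 * A) * expR (- C).
  have -> : 1 + A * (Q - eta - 1) = 1 + (C' - C + A * C - A).
    by rewrite -qcE; ring.
  apply: (@le_trans _ _ (expR (C' - C + A * C - A) * expR (- C'))).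
    by rewrite ler_wpM2r ?expR_ge0// expR_ge1Dx.
  rewrite -expRD.
  have -> : C' - C + A * C - A - C' = (- (A * (1 - C))) + - C by ring.
  rewrite expRD ler_wpM2r ?expR_ge0//.
  apply: (@le_trans _ _ ((1 + A * (1 - C))^-1)); first by apply: expRN_le; lra.
  rewrite -[leLHS]mul1r ler_pdivrMr; last by lra.
  have : 0 <= (2^-1 - A) * (A * (1 - C)) by rewrite mulr_ge0; lra.
  lra.
have C'2 : expR (- C') <= 2.
  rewrite expRN -[leRHS]invrK lef_pV2 ?posrE ?expR_gt0//.
  by apply: le_trans (expR_ge1Dx _); lra.
have V' : Y1 * expR (- C') <=
    (1 - 2^-1 * A) * (`|Y| * expR (- C)) + 2 * e * (C' - C + A * k).
  apply: (@le_trans _ _ (((1 + A * (Q - eta - 1)) * `|Y| +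
      A * (Q + eta) * e) * expR (- C'))).
    by rewrite ler_wpM2r ?expR_ge0.
  rewrite mulrDl lerD//.
    by rewrite mulrAC [leRHS]mulrA [leRHS]mulrAC ler_wpM2r.
  have -> : 2 * e * (C' - C + A * k) = (C' - C + A * k) * e * 2 by ring.
  rewrite ler_pM ?expR_ge0//; first by rewrite mulr_ge0// ltW.
  by rewrite ler_wpM2r// ltW.
apply: (@le_trans _ _ ((1 - 2^-1 * A) * (`|Y| * expR (- C)) +
    2 * e * (C' - C + A * k) - 2 * e * C' - K * e)).
  by rewrite !lerD2r.
rewrite -subr_ge0 [leRHS](_ : _ = A * e * (C + 2^-1 * K - 2 * k)); last by field.
by rewrite mulr_ge0 ?mulr_ge0 ?ltW// KE /k; lra.
Qed.

Lemma recursion_cvg0 (eta : R) (q c s y : nat -> R) : 0 <= eta ->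
  (forall n, 0 <= q n) ->
  (forall n, q n.+1 - eta = n.+1%:R * c n.+1 - n%:R * c n) ->
  c n @[n --> \oo] --> 0 -> s n @[n --> \oo] --> 0 ->
  (forall n, y n.+1 = (1 + n.+1%:R^-1 * (q n.+1 - eta - 1)) * y n +
                      n.+1%:R^-1 * (q n.+1 - eta) * s n) ->
  y n @[n --> \oo] --> 0.
Proof.
move=> eta0 q0 qc c0 s0 yS.
pose K := 8 * eta + 5.
pose V n := `|y n| * expR (- c n).
have key e : 0 < e ->
    \forall n \near \oo, V n - 2 * e * c n - K * e <= e.
  move=> e0.
  apply: (@harmonic_contraction 2^-1 _ _ _ e e0) => //.
  near=> n.
  apply: (@lyapunov_step eta e _ (q n.+1) _ _ _ _ (s n)) => //.
  - rewrite lef_pV2 ?posrE// ler_nat ltnS.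
    near: n; exact: nbhs_infty_ge.
  - rewrite mulrC ler_pdivrMr// mul1r (@le_trans _ _ n%:R)//; last by rewrite ler_nat.
    near: n; exact: nbhs_infty_ger.
  - by near: n; apply: (cvgr0_norm_le _ c0).
  - near: n; apply: (cvgr0_norm_le (fun n => c n.+1)) => //.
    by rewrite (cvg_shiftS c).
  - by near: n; apply: (cvgr0_norm_le _ s0).
  - by rewrite qc -natr1; field; rewrite natr1.
apply/cvgr0Pnorm_le => e e0.
have K0 : 0 < 2 * (K + 2) by rewrite /K; lra.
have := key _ (divr_gt0 e0 K0); set d := e / _ => Hd.
have d0 : 0 < d by rewrite divr_gt0.
near=> n.
have cn : `|c n| <= 4^-1 by near: n; apply: (cvgr0_norm_le _ c0).
have /andP[cl cu] : - 4^-1 <= c n <= 4^-1 by rewrite -ler_norml.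
have Vn : V n - 2 * d * c n - K * d <= d by near: n.
have E2 : expR (c n) <= 2.
  rewrite -[c n]opprK expRN -[leRHS]invrK lef_pV2 ?posrE ?expR_gt0//.
  by apply: le_trans (expR_ge1Dx _); lra.
have -> : `|y n| = V n * expR (c n) by rewrite /V -mulrA -expRD addNr expR0 mulr1.
have -> : e = (K + 2) * d * 2 by rewrite /d; field; rewrite gt_eqF//; lra.
have V0 : 0 <= V n by rewrite mulr_ge0 ?expR_ge0.
apply: ler_pM => //; rewrite ?expR_ge0//.
have : d * c n <= d * 4^-1 by rewrite (ler_wpM2l (ltW d0)).
lra.
Unshelve. all: by end_near. Qed.

End deterministic.

(** * Almost sure convergence along squares *)

Section squares.
Context {R : realType}.

(** Cauchy-Schwarz against the constant 1, by induction on the number of terms: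
    the step is the square (S - l a)^2, where S is the sum of the first l terms
    and a the next one. *)
Lemma sqr_sum_le (x : nat -> R) m l :
  (\sum_(m <= i < m + l) `|x i|) ^+ 2 <= l%:R * \sum_(m <= i < m + l) x i ^+ 2.
Proof.
elim: l => [|l IH]; first by rewrite addn0 !big_geq// expr0n mul0r.
rewrite addnS !big_nat_recr ?leq_addr//=.
case: l IH => [|l] IH.
  by rewrite addn0 !big_geq// !add0r mul1r real_normK// num_real.
set S := \sum_(_ <= _ < _) `|_| in IH *; set A := \sum_(_ <= _ < _) _ ^+ 2 in IH *.
rewrite -[x (m + l.+1)%N ^+ 2]real_normK ?num_real//; set a := `|_|.
have l0 : 0 < l.+1%:R :> R by [].
rewrite -[l.+2%:R]natr1; set L := l.+1%:R in IH l0 *.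
rewrite -subr_ge0 -(pmulr_rge0 _ l0).
have -> : L * ((L + 1) * (A + a ^+ 2) - (S + a) ^+ 2) =
  (S - L * a) ^+ 2 + (L + 1) * (L * A - S ^+ 2) by ring.
by rewrite addr_ge0 ?sqr_ge0// mulr_ge0 ?subr_ge0// addr_ge0// ltW.
Qed.

Lemma ex_sqrt n : exists K, (K ^ 2 <= n < K.+1 ^ 2)%N.
Proof.
have Ple K : (K ^ 2 <= n)%N -> (K <= n)%N.
  by apply: leq_trans; case: K => // K; rewrite expnS expn1 leq_pmulr.
have ex : exists K, (K ^ 2 <= n)%N by exists 0%N.
exists (ex_maxn ex Ple); case: ex_maxnP => K KK max; rewrite KK/= ltnNge.
by apply/negP => /max; rewrite ltnn.
Qed.

(** A bound, quadratic in the terms, for both errors made when the average over n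
    terms is compared with 0 along the squares: the partial sum at (k+1)^2, and
    the variation over the 2 (k+1) + 1 indices up to the next square.  Its mean
    is of order k^-2 for uncorrelated terms, hence summable. *)
Definition block_defect (x : nat -> R) (k : nat) : R :=
  ((\sum_(0 <= i < k.+1 ^ 2) x i) ^+ 2 +
   (k.+1.*2.+1)%:R * \sum_(k.+1 ^ 2 <= i < k.+2 ^ 2) x i ^+ 2) / k.+1%:R ^+ 4.

Lemma sq_succ k : (k.+2 ^ 2 = k.+1 ^ 2 + k.+1.*2.+1)%N.
Proof. by rewrite -[k.+2]addn1 sqrnD exp1n muln1 mul2n -addnA add1n. Qed.

Lemma block_defect_cvg0 (x : nat -> R) :
  block_defect x k @[k --> \oo] --> 0 ->
  n%:R^-1 * (\sum_(0 <= i < n) x i) @[n --> \oo] --> 0.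
Proof.
move=> Z0; apply/cvgr0Pnorm_le => e e0.
have e4 : 0 < (e / 2) ^+ 2 by rewrite exprn_gt0// divr_gt0.
have [k0 _ Hk0] := cvgr0_norm_le _ Z0 _ e4.
near=> n.
have n0 : (0 < n)%N by near: n; exact: nbhs_infty_gt.
have [K /andP[Kn nK]] := ex_sqrt n.
have kK : (k0 < K)%N.
  have : (k0.+2 ^ 2 <= n)%N by near: n; exact: nbhs_infty_ge.
  by move=> /leq_ltn_trans /(_ nK); rewrite ltn_sqr ltnS => /ltnW.
case: K kK Kn nK => // k; rewrite ltnS => kk0 Kn nK.
have := Hk0 k kk0.
set K := k.+1; have K0 : 0 < K%:R :> R by [].
rewrite /block_defect -/K.
set S := \sum_(0 <= i < K ^ 2) x i.
set A := \sum_(_ <= i < _) _ ^+ 2.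
set B := \sum_(K ^ 2 <= i < K.+1 ^ 2) `|x i|.
have AB : B ^+ 2 <= K.*2.+1%:R * A by rewrite /B /A sq_succ; exact: sqr_sum_le.
have A0 : 0 <= K.*2.+1%:R * A by apply: le_trans AB; exact: sqr_ge0.
rewrite ger0_norm; last by rewrite divr_ge0 ?exprn_ge0// addr_ge0// sqr_ge0.
rewrite ler_pdivrMr ?exprn_gt0// => SA.
have B0 : 0 <= B by apply: sumr_ge0.
have eK : (e / 2 * K%:R ^+ 2) ^+ 2 = (e / 2) ^+ 2 * K%:R ^+ 4 by ring.
have e2K : 0 <= e / 2 * K%:R ^+ 2.
  by rewrite mulr_ge0 ?exprn_ge0// divr_ge0// ltW.
have SK : `|S| <= e / 2 * K%:R ^+ 2.
  rewrite -ler_sqr ?nnegrE//.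
  rewrite eK real_normK ?num_real//; apply: le_trans SA.
  by rewrite lerDl.
have BK : B <= e / 2 * K%:R ^+ 2.
  rewrite -ler_sqr ?nnegrE//.
  rewrite eK; apply: le_trans SA; apply: (le_trans AB).
  by rewrite lerDr sqr_ge0.
rewrite normrM ger0_norm ?invr_ge0// mulrC ler_pdivrMr ?ltr0n//.
rewrite (big_cat_nat _ Kn)//= -/S.
apply: (@le_trans _ _ (`|S| + B)).
  rewrite (le_trans (ler_normD _ _))// lerD2l (le_trans (ler_norm_sum _ _ _))//.
  rewrite /B (big_cat_nat Kn (ltnW nK))/= lerDl.
  by apply: sumr_ge0.
apply: (@le_trans _ _ (e * K%:R ^+ 2)); first by lra.
by rewrite (ler_wpM2l (ltW e0))// -natrX ler_nat.
Unshelve. all: by end_near. Qed.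

End squares.

Section mean.
Context {d : measure_display} {T : measurableType d} {R : realType}.
Variable P : probability T R.

(** Nonnegative variables with summable means have an almost surely convergent
    sum, whose terms tend to 0.  The series of 1/k^2 is bounded by a telescoping
    one. *)
Lemma ae_cvg0 (Z : nat -> T -> R) (M : R) :
  (forall k w, 0 <= Z k w) ->
  (forall k, P.-integrable setT (EFin \o Z k)) ->
  (forall k, \int[P]_w Z k w <= M / k.+1%:R ^+ 2) ->
  {ae P, forall w, Z k w @[k --> \oo] --> (0 : R)}.
Proof.
move=> Z0 iZ leZ.
have mZ k : measurable_fun [set: T] (Z k).
  by apply/measurable_EFinP/(measurable_int P); exact: iZ.
have mZE k : measurable_fun [set: T] (fun w => (Z k w)%:E).
  exact/measurable_EFinP.
have Z0E k w : (0 <= (Z k w)%:E)%E by rewrite lee_fin.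
have M0 : 0 <= M.
  have := leZ 0%N; rewrite expr1n divr1; apply: le_trans.
  by apply: Rintegral_ge0.
(* From 1/m^2 <= 2/m - 2/(m+1). *)
have sumle n : \sum_(0 <= k < n) (M / k.+1%:R ^+ 2) <= 2 * M - 2 * M / n.+1%:R.
  elim: n => [|n IH]; first by rewrite big_geq// divr1 subrr.
  rewrite big_nat_recr//= (le_trans (lerD IH (lexx _)))//.
  rewrite -subr_ge0 -[n.+2%:R]natr1; set m := n.+1%:R.
  have m1 : 1 <= m :> R by rewrite ler1n.
  have -> : 2 * M - 2 * M / (m + 1) - (2 * M - 2 * M / m + M / m ^+ 2) =
     M * (m - 1) / (m ^+ 2 * (m + 1)).
    by field; rewrite !gt_eqF//; lra.
  by rewrite divr_ge0 ?mulr_ge0 ?exprn_ge0//; lra.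
have fin : (\int[P]_w (\sum_(0 <= k <oo) (Z k w)%:E) < +oo)%E.
  rewrite integral_nneseries//.
  apply: (@le_lt_trans _ _ (2 * M)%:E); last by rewrite ltry.
  apply: lime_le.
    by apply: is_cvg_nneseries => n _ _; apply: integral_ge0 => w _; rewrite lee_fin.
  near=> n.
  apply: (@le_trans _ _ (\sum_(0 <= k < n) (\int[P]_w Z k w)%:E)%E).
    apply: lee_sum => k _; rewrite /Rintegral fineK//.
    exact: integrable_fin_num (iZ k).
  rewrite sumEFin lee_fin (le_trans (ler_sum _ (fun k _ => leZ k)))//.
  by rewrite (le_trans (sumle n))// gerBl divr_ge0// mulr_ge0.
have iS : P.-integrable setT (fun w => \sum_(0 <= k <oo) (Z k w)%:E)%E.
  apply/integrableP; split.
    by apply: ge0_emeasurable_sum => // k w _ _; rewrite lee_fin.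
  under eq_integral => w _ do
    rewrite gee0_abs ?(nneseries_ge0 (fun k _ _ => Z0E k w))//.
  by [].
have := integrable_ae measurableT iS.
apply: filterS => w /(_ I) Sfin.
apply: cvg_series_cvg_0.
apply: nondecreasing_is_cvgn; first by apply: nondecreasing_series.
exists (fine (\sum_(0 <= k <oo) (Z k w)%:E)%E) => _ [n _ <-].
rewrite -lee_fin fineK// /series/= -sumEFin.
by apply: nneseries_lim_ge => k _ _; rewrite lee_fin.
Unshelve. all: by end_near. Qed.

End mean.

(** * A law of large numbers for uncorrelated sequences *)

Section dot.
Context {d : measure_display} {T : measurableType d} {R : realType}.
Variable P : probability T R.
Implicit Types X Y Z : T -> R.

Local Notation L2 := (Lfun P 2%:E).
Local Notation integ X := (P.-integrable setT (EFin \o X)).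

(** The inner product of square integrable variables. *)
Definition dot X Y : R := \int[P]_w (X w * Y w).

Lemma L2_measurable X : X \in L2 -> measurable_fun [set: T] X.
Proof. by rewrite inE => /andP[]; rewrite inE. Qed.

Lemma L2M X Y : X \in L2 -> Y \in L2 -> integ (fun w => X w * Y w).
Proof. by move=> lX lY; apply/Lfun1_integrable; exact: Lfun2_mul_Lfun1. Qed.

Lemma L2D X Y : X \in L2 -> Y \in L2 -> (fun w => X w + Y w) \in L2.
Proof. by move=> lX lY; apply: rpredD => //; rewrite lee1n. Qed.

Lemma L2Z a X : X \in L2 -> (fun w => a * X w) \in L2.
Proof.
move=> lX; rewrite (_ : (fun _ => _) = a \o* X); last first.
  by apply/funext => w /=; rewrite mulrC.
by apply: Lfun_scale => //; rewrite ler1n.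
Qed.

Lemma L2_cst (c : R) : (fun _ : T => c) \in L2.
Proof. exact: Lfun_cst. Qed.

Lemma L2_sum (X : nat -> T -> R) m n : (forall i, X i \in L2) ->
  (fun w => \sum_(m <= i < n) X i w) \in L2.
Proof.
move=> lX; elim: n => [|n IH].
  under eq_fun do rewrite big_geq//.
  exact: L2_cst.
have [mn|nm] := leqP m n.
  under eq_fun do rewrite big_nat_recr//=.
  exact: L2D.
under eq_fun do rewrite big_geq//.
exact: L2_cst.
Qed.

Lemma L2_of_sqr X : measurable_fun setT X -> integ (fun w => X w ^+ 2) -> X \in L2.
Proof.
move=> mX /integrableP[_ iX]; rewrite inE; apply/andP; split; rewrite inE//=.
rewrite /finite_norm unlock poweR_lty//.
apply: le_lt_trans iX; apply: ge0_le_integral => //.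
- by move=> w _; rewrite poweR_ge0.
- apply/measurable_EFinP/(measurableT_comp (measurable_powR _)).
  exact: measurableT_comp.
- by apply: measurableT_comp => //; apply/measurable_EFinP; exact: measurable_funX.
- by move=> w _; rewrite lee_fin powR_mulrn// -normrX.
Qed.

Lemma dotC X Y : dot X Y = dot Y X.
Proof. by rewrite /dot; under eq_Rintegral do rewrite mulrC. Qed.

Lemma dotDl X Y Z : X \in L2 -> Y \in L2 -> Z \in L2 ->
  dot (fun w => X w + Y w) Z = dot X Z + dot Y Z.
Proof.
move=> lX lY lZ; rewrite /dot -RintegralD//; [|exact: L2M..].
by apply: eq_Rintegral => w _; rewrite mulrDl.
Qed.

Lemma dot_sqrD X Y : X \in L2 -> Y \in L2 ->
  dot (fun w => X w + Y w) (fun w => X w + Y w) =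
  dot X X + 2 * dot X Y + dot Y Y.
Proof.
move=> lX lY; have lXY := L2D lX lY.
rewrite dotDl// (dotC X) (dotC Y) !dotDl// (dotC Y X).
by rewrite mulr_natl mulr2n !addrA.
Qed.

Lemma dotZl a X Z : X \in L2 -> Z \in L2 ->
  dot (fun w => a * X w) Z = a * dot X Z.
Proof.
move=> lX lZ; rewrite /dot -RintegralZl//; last exact: L2M.
by apply: eq_Rintegral => w _; rewrite mulrA.
Qed.

Lemma dot_sum0 (X : nat -> T -> R) Z m n : (forall i, X i \in L2) -> Z \in L2 ->
  (forall i, (i < n)%N -> dot (X i) Z = 0) ->
  dot (fun w => \sum_(m <= i < n) X i w) Z = 0.
Proof.
move=> lX lZ; elim: n => [|n IH] XZ.
  rewrite /dot; under eq_Rintegral do rewrite big_geq// mul0r.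
  by rewrite /Rintegral integral0.
have [mn|nm] := leqP m n; last first.
  rewrite /dot; under eq_Rintegral do rewrite big_geq// mul0r.
  by rewrite /Rintegral integral0.
rewrite /dot; under eq_Rintegral do rewrite big_nat_recr//=.
rewrite -/(dot _ _) dotDl//; last exact: L2_sum.
by rewrite IH ?XZ ?addr0// => i /ltnW; exact: XZ.
Qed.

Lemma dot_sum_sqr_le (X : nat -> T -> R) (C : R) n : (forall i, X i \in L2) ->
  (forall i j, (i < j)%N -> dot (X i) (X j) = 0) ->
  (forall i, dot (X i) (X i) <= C) ->
  dot (fun w => \sum_(0 <= i < n) X i w) (fun w => \sum_(0 <= i < n) X i w)
    <= n%:R * C.
Proof.
move=> lX X0 XC; elim: n => [|n IH].
  rewrite /dot; under eq_Rintegral do rewrite big_geq// mul0r.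
  by rewrite /Rintegral integral0 mul0r.
have lS : (fun w => \sum_(0 <= i < n) X i w) \in L2 by exact: L2_sum.
have SX : dot (fun w => \sum_(0 <= i < n) X i w) (X n) = 0.
  by apply: dot_sum0 => // i; exact: X0.
rewrite (_ : (fun w => \sum_(0 <= i < n.+1) X i w) =
  (fun w => \sum_(0 <= i < n) X i w + X n w)); last first.
  by apply/funext => w; rewrite big_nat_recr.
by rewrite dot_sqrD// SX mulr0 addr0 -natr1 mulrDl mul1r lerD.
Qed.

(** Second moments control the averages only along a subsequence; along the
    squares the error is summable, and [block_defect_cvg0] fills the gaps without
    a maximal inequality. *)
Lemma slln_uncorrelated (X : nat -> T -> R) (C : R) : (forall i, X i \in L2) ->
  (forall i j, (i < j)%N -> dot (X i) (X j) = 0) ->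
  (forall i, dot (X i) (X i) <= C) ->
  {ae P, forall w, n%:R^-1 * (\sum_(0 <= i < n) X i w) @[n --> \oo] --> (0 : R)}.
Proof.
move=> lX X0 XC.
have isq Y : Y \in L2 -> integ (fun w => Y w ^+ 2).
  by move=> lY; under eq_fun do rewrite expr2; exact: L2M.
have isum m n : integ (fun w => \sum_(m <= i < n) X i w ^+ 2).
  rewrite (_ : _ \o _ = (fun w => \sum_(m <= i < n) (X i w ^+ 2)%:E)%E).
    by apply: integrable_sum => // i _; exact: isq.
  by apply/funext => w /=; rewrite sumEFin.
have Esum m l : \int[P]_w (\sum_(m <= i < m + l) X i w ^+ 2) <= l%:R * C.
  elim: l => [|l IH].
    under eq_Rintegral do rewrite addn0 big_geq//.
    by rewrite /Rintegral integral0 mul0r.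
  under eq_Rintegral do rewrite addnS big_nat_recr ?leq_addr//=.
  rewrite RintegralD//; last exact: isq.
  rewrite -natr1 mulrDl mul1r lerD//.
  by apply: le_trans (XC (m + l)%N); rewrite /dot; under eq_Rintegral do rewrite expr2.
have C0 : 0 <= C.
  by apply: le_trans (XC 0%N); apply: Rintegral_ge0 => w _; rewrite -expr2 sqr_ge0.
suff : {ae P, forall w, block_defect (X ^~ w) k @[k --> \oo] --> (0 : R)}.
  by apply: filterS => w; exact: block_defect_cvg0.
have i1 k : integ (fun w => (\sum_(0 <= i < k.+1 ^ 2) X i w) ^+ 2).
  by apply: isq; exact: L2_sum.
have i2 k : integ (fun w => k.+1.*2.+1%:R * \sum_(k.+1 ^ 2 <= i < k.+2 ^ 2) X i w ^+ 2).
  rewrite (_ : _ \o _ = (fun w => k.+1.*2.+1%:R%:E *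
     (\sum_(k.+1 ^ 2 <= i < k.+2 ^ 2) X i w ^+ 2)%:E)%E)//.
  by apply: integrableZl => //; exact: isum.
have i12 k : integ (fun w => (\sum_(0 <= i < k.+1 ^ 2) X i w) ^+ 2 +
    k.+1.*2.+1%:R * \sum_(k.+1 ^ 2 <= i < k.+2 ^ 2) X i w ^+ 2).
  exact: (integrableD measurableT (i1 k) (i2 k)).
apply: (@ae_cvg0 _ _ _ P _ (10 * C)).
- move=> k w; rewrite /block_defect divr_ge0 ?exprn_ge0// addr_ge0 ?sqr_ge0//.
  by rewrite mulr_ge0//; apply: sumr_ge0 => i _; exact: sqr_ge0.
- move=> k; rewrite /block_defect.
  exact: (integrableZr measurableT _ (i12 k)).
move=> k; rewrite /block_defect RintegralZr//.
rewrite RintegralD// RintegralZl//.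
set K := k.+1; have K1 : 1 <= K%:R :> R by rewrite ler1n.
have l1 : \int[P]_w (\sum_(0 <= i < K ^ 2) X i w) ^+ 2 <= K%:R ^+ 2 * C.
  rewrite -natrX; apply: le_trans (dot_sum_sqr_le (K ^ 2) lX X0 XC).
  by rewrite /dot; under eq_Rintegral do rewrite expr2.
have l2 : \int[P]_w (\sum_(K ^ 2 <= i < K.+1 ^ 2) X i w ^+ 2) <= K.*2.+1%:R * C.
  by rewrite /K sq_succ; exact: Esum.
have KE : K.*2.+1%:R = 2 * K%:R + 1 :> R by rewrite -natr1 -mul2n natrM.
rewrite KE in l2 *; set a := \int[P]_w _ in l1 *; set b := \int[P]_w _ in l2 *.
set m := K%:R in K1 l1 l2 *.
have m0 : 0 < m by lra.
rewrite ler_pdivrMr ?exprn_gt0//.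
have -> : 10 * C / m ^+ 2 * m ^+ 4 = 10 * C * m ^+ 2 by field; rewrite gt_eqF.
apply: (@le_trans _ _ (m ^+ 2 * C + (2 * m + 1) * ((2 * m + 1) * C))).
  by rewrite lerD// ler_wpM2l//; lra.
have -> : m ^+ 2 * C + (2 * m + 1) * ((2 * m + 1) * C) =
  (m ^+ 2 + (2 * m + 1) ^+ 2) * C by ring.
have -> : 10 * C * m ^+ 2 = (10 * m ^+ 2) * C by ring.
rewrite ler_wpM2r//.
have : (2 * m + 1) ^+ 2 <= (3 * m) ^+ 2 by rewrite ler_sqr ?nnegrE; lra.
have -> : (3 * m) ^+ 2 = 9 * m ^+ 2 by ring.
lra.
Qed.

End dot.

(** * Functions of finitely many coin tosses *)

Section coins.
Context {d : measure_display} {T : measurableType d} {R : realType}.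
Variable P : probability T R.
Variables (alpha : R) (b : nat -> T -> bool).
Implicit Types (f g : seq bool -> R).

Local Notation integ X := (P.-integrable setT (EFin \o X)).

Definition weight (s : seq bool) : R :=
  \prod_(x <- s) (if x then alpha else 1 - alpha).

(** The most recent toss comes first, so that one more toss is a [cons]. *)
Definition history n w : seq bool := rev (mkseq (b ^~ w) n).

Lemma historyS n w : history n.+1 w = b n w :: history n w.
Proof. by rewrite /history mkseqS rev_rcons. Qed.

Lemma size_history n w : size (history n w) = n.
Proof. by rewrite size_rev size_mkseq. Qed.

Lemma history_drop i j w : (i <= j)%N -> history i w = drop (j - i) (history j w).
Proof.
move=> ij; rewrite -{2}(subnKC ij) addnC; elim: (j - i)%N => [|n IH].
  by rewrite drop0.
by rewrite addSn historyS.
Qed.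

Fixpoint words n : seq (seq bool) :=
  if n is n'.+1 then map (cons true) (words n') ++ map (cons false) (words n')
  else [:: [::]].

(** The mean of [f] over n tosses, averaging over the last toss first: unfolding
    the recursion once is conditioning on all the tosses but the last one. *)
Fixpoint coin_mean n (f : seq bool -> R) : R :=
  if n is n'.+1 then
    coin_mean n' (fun s => alpha * f (true :: s) + (1 - alpha) * f (false :: s))
  else f [::].

Lemma size_words n s : s \in words n -> size s = n.
Proof.
elim: n s => [|n IH] s /=; first by rewrite inE => /eqP ->.
by rewrite mem_cat => /orP[] /mapP[s' /IH <- ->].
Qed.

Lemma coin_meanE n f : coin_mean n f = \sum_(s <- words n) f s * weight s.
Proof.
elim: n f => [|n IH] f /=; first by rewrite big_seq1 /weight big_nil mulr1.
rewrite IH big_cat/= !big_map -big_split/=; apply: eq_bigr => s _.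
by rewrite /weight !big_cons mulrDl; congr (_ + _); ring.
Qed.

Lemma words_pick n f (s : seq bool) : size s = n ->
  f s = \sum_(t <- words n) f t * (s == t)%:R :> R.
Proof.
elim: n f s => [|n IH] f s.
  by move/size0nil => ->; rewrite big_seq1 eqxx mulr1.
case: s => // x s [sn] /=; rewrite big_cat/= !big_map (IH (fun t => f (x :: t)) s)//.
have E0 (y z : bool) : y != z ->
    \sum_(t <- words n) f (z :: t) * ((y :: s) == (z :: t))%:R = 0 :> R.
  move=> /negbTE yz; rewrite big1// => t _.
  by rewrite eqseq_cons yz mulr0.
have E1 (y : bool) : \sum_(t <- words n) f (y :: t) * ((y :: s) == (y :: t))%:R =
    \sum_(t <- words n) f (y :: t) * (s == t)%:R :> R.
  by apply: eq_bigr => t _; rewrite eqseq_cons eqxx.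
by case: x; rewrite E1 E0// ?addr0 ?add0r.
Qed.

Lemma coin_mean_le n f g : 0 <= alpha <= 1 -> (forall s, f s <= g s) ->
  coin_mean n f <= coin_mean n g.
Proof.
move=> /andP[a0 a1] fg; rewrite !coin_meanE; apply: ler_sum => s _.
by rewrite ler_wpM2r// /weight prodr_ge0// => -[] _; rewrite ?subr_ge0.
Qed.

Lemma coin_meanD n f g :
  coin_mean n (fun s => f s + g s) = coin_mean n f + coin_mean n g.
Proof. by rewrite !coin_meanE -big_split/=; apply: eq_bigr => s _; ring. Qed.

Lemma coin_meanZ n a f : coin_mean n (fun s => a * f s) = a * coin_mean n f.
Proof. by rewrite !coin_meanE mulr_sumr; apply: eq_bigr => s _; ring. Qed.

Lemma weight_sum1 n : \sum_(s <- words n) weight s = 1.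
Proof.
transitivity (coin_mean n (fun=> 1)).
  by rewrite coin_meanE; apply: eq_bigr => s _; rewrite mul1r.
elim: n => //= n; under [X in _ -> coin_mean n X = _]eq_fun do
  rewrite !mulr1 addrC subrK.
by [].
Qed.

Lemma coin_mean_cst n c : coin_mean n (fun=> c) = c.
Proof. by rewrite coin_meanE -mulr_sumr weight_sum1 mulr1. Qed.

Hypothesis mb : forall n, measurable [set w | b n w].
Hypothesis Pb : forall s, P [set w | history (size s) w = s] = (weight s)%:E.

Lemma measurable_history s n : measurable [set w | history n w = s].
Proof.
elim: n s => [|n IH] s.
  have [->|s0] := eqVneq s [::].
    by rewrite (_ : [set _ | _] = setT)//; apply/seteqP.
  rewrite (_ : [set _ | _] = set0)//; apply/seteqP; split => // w /=.
  by rewrite /history/= => /esym/eqP; rewrite (negbTE s0).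
case: s => [|x s].
  rewrite (_ : [set _ | _] = set0)//; apply/seteqP; split => // w /=.
  by rewrite historyS.
rewrite (_ : [set _ | _] = [set w | b n w = x] `&` [set w | history n w = s]).
  apply: measurableI => //; case: x; first exact: mb.
  rewrite (_ : [set _ | _] = ~` [set w | b n w]); first exact: measurableC.
  by apply/seteqP; split => w /=; case: (b n w).
by apply/seteqP; split => w /=; rewrite historyS; [case|move=> [-> ->]].
Qed.

Lemma history_fun_EFin n f w : (f (history n w))%:E =
  (\sum_(s <- words n) (f s * \1_[set w | history n w = s] w)%:E)%E.
Proof.
rewrite (words_pick f (size_history n w)) -sumEFin; apply: eq_bigr => s _.
rewrite indicE; congr (_ * _%:R)%:E; congr nat_of_bool.
by apply/eqP/idP => [h|]; [rewrite inE|rewrite inE].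
Qed.

Lemma integrable_cell n f s :
  P.-integrable setT (fun w => (f s * \1_[set w | history n w = s] w)%:E).
Proof.
rewrite (_ : (fun _ => _) = (fun w => (f s)%:E * (\1_[set w | history n w = s] w)%:E)%E)//.
apply: integrableZl => //.
apply/integrable_indic => //; exact: measurable_history.
Qed.

Lemma integrable_history n f : integ (fun w => f (history n w)).
Proof.
rewrite (_ : _ \o _ = (fun w => \sum_(s <- words n)
  (f s * \1_[set w | history n w = s] w)%:E)%E); last first.
  by apply/funext => w; rewrite /= history_fun_EFin.
by apply: integrable_sum => // s _; exact: integrable_cell.
Qed.

(** All probabilistic statements about the walk go through this lemma, which turns
    them into finite computations with [coin_mean]. *)
Lemma mean_history n f : \int[P]_w f (history n w) = coin_mean n f.
Proof.
rewrite /Rintegral; under eq_integral do rewrite history_fun_EFin.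
rewrite integral_sum//; last by move=> s; exact: integrable_cell.
rewrite coin_meanE -[RHS]/(fine _%:E) -sumEFin; congr fine.
rewrite big_seq [RHS]big_seq; apply: eq_bigr => s /size_words sn.
rewrite (_ : (fun _ => _) = (fun w => (f s)%:E * (\1_[set w | history n w = s] w)%:E)%E)//.
rewrite integralZl//; last first.
  apply/integrable_indic => //; exact: measurable_history.
rewrite integral_indic ?setIT//; last exact: measurable_history.
by rewrite EFinM; congr (_ * _)%E; have := Pb s; rewrite sn.
Qed.

Lemma L2_history n f : (fun w => f (history n w)) \in Lfun P 2%:E.
Proof.
apply: L2_of_sqr.
  by apply/measurable_EFinP/(measurable_int P); exact: integrable_history.
exact: (integrable_history n (fun s => f s ^+ 2)).
Qed.

End coins.

(** * The reflected walk *)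

Section queue.
Context {R : realType}.
Variables (alpha : R) (q0 : nat).

(** Reflection at 0 is the truncated predecessor. *)
Definition qstep (x : bool) (q : nat) : nat := if x then q.+1 else q.-1.

Definition qlen (s : seq bool) : nat := foldr qstep q0 s.

Definition sgn_coin (x : bool) : R := if x then 1 else -1.

(** The function q (q + 1) solves the Poisson equation of the walk up to the exact
    martingale increment; no boundary correction appears because at q = 0 a step
    down leaves q (q + 1) unchanged and contributes - 1 + 1. *)
Lemma qlen_identity x s : let q := (qlen s)%:R : R in let q' := (qlen (x :: s))%:R in
  q' * (q' + 1) = q * (q + 1) + (2 * q + 1) * sgn_coin x + 1.
Proof.
rewrite /=; case: x => /=; first by rewrite -natr1; ring.
by case: (qlen s) => [|q] /=; [ring|rewrite -natr1; ring].
Qed.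

(** The base r = 1 / (2 alpha) lies between the two zeros 1 and (1 - alpha) / alpha
    of alpha r^2 - r + (1 - alpha), so the drift factor
    k = alpha r + (1 - alpha) / r of r^q is below 1 away from 0; at q = 0 the
    reflection costs at most 1. *)
Lemma qlen_exp_bounded : 0 < alpha -> alpha < 2^-1 -> exists B : R, forall n,
  coin_mean alpha n (fun s => (2 * alpha)^-1 ^+ qlen s) <= B.
Proof.
move=> a0 a2.
have a01 : 0 <= alpha <= 1 by apply/andP; split; lra.
pose r := (2 * alpha)^-1; pose k := 2^-1 + 2 * alpha * (1 - alpha).
have r0 : 0 < r by rewrite invr_gt0 mulr_gt0.
have r1 : 1 <= r by rewrite -[leLHS]invr1 lef_pV2 ?posrE ?mulr_gt0//; lra.
have k1 : k < 1.
  have : 0 < (2^-1 - alpha) ^+ 2 by rewrite exprn_gt0// subr_gt0.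
  have -> : (2^-1 - alpha) ^+ 2 = 4^-1 - alpha * (1 - alpha) by field.
  by rewrite /k; lra.
have k0 : 0 <= k by rewrite addr_ge0// mulr_ge0; lra.
have drift n : coin_mean alpha n.+1 (fun s => r ^+ qlen s) <=
    k * coin_mean alpha n (fun s => r ^+ qlen s) + 1.
  rewrite -coin_meanZ -[X in _ + X](coin_mean_cst alpha n) -coin_meanD /=.
  apply: coin_mean_le => // s; rewrite -/(qlen _).
  have rN (q : nat) : r ^+ q.-1 <= r ^+ q / r + 1.
    case: q => [|q] /=; first by rewrite lerDr divr_ge0 ?expr0// ltW.
    by rewrite exprSr mulfK ?gt_eqF// lerDl.
  apply: (@le_trans _ _ (alpha * r ^+ (qlen s).+1 + (1 - alpha) * (r ^+ qlen s / r + 1))).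
    by rewrite lerD2l ler_wpM2l//; lra.
  have -> : alpha * r ^+ (qlen s).+1 + (1 - alpha) * (r ^+ qlen s / r + 1) =
      k * r ^+ qlen s + (1 - alpha).
    by rewrite exprS /k /r; field; rewrite !gt_eqF.
  by rewrite lerD2l; lra.
exists (r ^+ q0 + (1 - k)^-1); elim => [|n IH].
  by rewrite /= lerDl invr_ge0 subr_ge0 ltW.
apply: (le_trans (drift n)).
apply: (@le_trans _ _ (k * (r ^+ q0 + (1 - k)^-1) + 1)).
  by rewrite lerD2r ler_wpM2l.
have -> : k * (r ^+ q0 + (1 - k)^-1) + 1 = k * r ^+ q0 + (1 - k)^-1.
  by field; rewrite gt_eqF// subr_gt0.
by rewrite lerD2r ler_piMl ?exprn_ge0// ltW.
Qed.

(** With t^4 = r, Bernoulli's inequality bounds q + 1 by a multiple of t^q, and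
    hence (q + 1)^4 by a multiple of r^q. *)
Lemma qlen_pow4_bounded : 0 < alpha -> alpha < 2^-1 -> exists C : R, forall n,
  coin_mean alpha n (fun s => ((qlen s)%:R + 1) ^+ 4) <= C.
Proof.
move=> a0 a2.
have a01 : 0 <= alpha <= 1 by apply/andP; split; lra.
have [B HB] := qlen_exp_bounded a0 a2.
pose r := (2 * alpha)^-1; pose t := Num.sqrt (Num.sqrt r).
have r1 : 1 < r by rewrite -[ltLHS]invr1 ltf_pV2 ?posrE ?mulr_gt0//; lra.
have sqrt1 (x : R) : 1 < x -> 1 < Num.sqrt x.
  by move=> x1; rewrite -[ltLHS]sqrtr1 ltr_sqrt// (lt_trans _ x1).
have t1 : 1 < t by rewrite !sqrt1.
have t4 : t ^+ 4 = r.
  have r0 : 0 <= r by rewrite (le_trans _ (ltW r1)).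
  by rewrite (exprM _ 2 2) !sqr_sqrtr ?sqrtr_ge0.
(* This choice makes both c <= 1 and c <= t - 1 hold. *)
pose c := (t - 1) / t.
have c0 : 0 < c by rewrite divr_gt0 ?subr_gt0// (lt_trans _ t1).
have bern (q : nat) : c * (q%:R + 1) <= t ^+ q.
  apply: (@le_trans _ _ (1 + q%:R * (t - 1))).
    have c1 : c <= 1 by rewrite ler_pdivrMr ?(lt_trans _ t1)//; lra.
    have ct : c <= t - 1 by rewrite ler_pdivrMr ?(lt_trans _ t1)// ler_peMr ?subr_ge0// ltW.
    rewrite mulrDr mulr1 addrC lerD// mulrC ler_wpM2l//.
  elim: q => [|q IH]; first by rewrite mul0r addr0 expr0.
  rewrite exprS -natr1; apply: (@le_trans _ _ (t * (1 + q%:R * (t - 1)))).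
    rewrite -subr_ge0.
    have -> : t * (1 + q%:R * (t - 1)) - (1 + (q%:R + 1) * (t - 1)) = q%:R * (t - 1) ^+ 2 by ring.
    by rewrite mulr_ge0// sqr_ge0.
  by rewrite ler_wpM2l// (le_trans _ (ltW t1)).
exists (c ^- 4 * B) => n.
apply: (@le_trans _ _ (c ^- 4 * coin_mean alpha n (fun s => r ^+ qlen s))); last first.
  by rewrite ler_wpM2l// invr_ge0 exprn_ge0// ltW.
rewrite -coin_meanZ; apply: coin_mean_le => // s.
rewrite mulrC ler_pdivlMr ?exprn_gt0// -t4 -exprM mulnC exprM -exprMn mulrC.
apply: lerXn2r; rewrite ?nnegrE //.
  by rewrite mulr_ge0 ?addr_ge0// ltW.
by rewrite exprn_ge0// ltW// (lt_trans _ t1).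
Qed.

End queue.

(** * The long-run average of the reflected walk *)

Section queue_average.
Context {d : measure_display} {T : measurableType d} {R : realType}.
Variable P : probability T R.
Variables (alpha : R) (b : nat -> T -> bool) (q0 : nat).
Hypothesis a0 : 0 < alpha.
Hypothesis a2 : alpha < 2^-1.
Hypothesis mb : forall n, measurable [set w | b n w].
Hypothesis Pb : forall s,
  P [set w | history b (size s) w = s] = (weight alpha s)%:E.

Local Notation q n w := ((qlen q0 (history b n w))%:R : R).

(** The centred part of the increment in [qlen_identity], where 2 alpha - 1 is the
    mean of a step.  It has conditional mean 0 given the earlier tosses, hence is
    uncorrelated with every earlier increment. *)
Definition queue_increment (s : seq bool) : R :=
  if s is x :: s' then (2 * (qlen q0 s')%:R + 1) * (sgn_coin x - (2 * alpha - 1)) else 0.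

Lemma queue_increment_slln : {ae P, forall w,
  n%:R^-1 * (\sum_(0 <= i < n) queue_increment (history b i.+1 w)) @[n --> \oo] --> (0 : R)}.
Proof.
have [C HC] := @qlen_pow4_bounded R alpha q0 a0 a2.
have a01 : 0 <= alpha <= 1 by have := a0; have := a2 => *; apply/andP; split; lra.
apply: (@slln_uncorrelated _ _ _ P (fun i w => queue_increment (history b i.+1 w)) (16 * C)).
- by move=> i; exact: (L2_history P mb i.+1 queue_increment).
- move=> i j ij; rewrite /dot.
  pose F (s : seq bool) := queue_increment (drop (j - i) s) * queue_increment s.
  rewrite (_ : \int[P]_w _ = \int[P]_w F (history b j.+1 w)); last first.
    apply: eq_Rintegral => w _; rewrite /F; congr (queue_increment _ * _).
    by rewrite (@history_drop _ _ _ i.+1 j.+1) ?subSS// ltnW.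
  rewrite (mean_history mb Pb) /=.
  rewrite (_ : (fun _ => _) = fun=> 0) ?coin_mean_cst//.
  apply/funext => s; rewrite /F -(subnSK ij) /=; ring.
- move=> i; rewrite /dot.
  rewrite (mean_history mb Pb i.+1 (fun s => queue_increment s * queue_increment s)).
  apply: (@le_trans _ _ (coin_mean alpha i.+1 (fun s => 16 * ((qlen q0 (behead s))%:R + 1) ^+ 4))).
    apply: coin_mean_le => // -[|x s] /=.
      by rewrite mul0r mulr_ge0// exprn_ge0// addr_ge0.
    set Q := (qlen q0 s)%:R; have Q0 : 0 <= Q :> R by rewrite ler0n.
    set D := _ - _; have D2 : D ^+ 2 <= 4.
      have -> : 4 = 2 ^+ 2 :> R by ring.
      rewrite -real_normK ?num_real// ler_sqr ?nnegrE//.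
      move/andP: a01 => [? ?].
      by rewrite ler_norml /D; case: (x) => /=; apply/andP; split; lra.
    rewrite -expr2 exprMn.
    apply: (@le_trans _ _ ((2 * (Q + 1)) ^+ 2 * 4)).
      apply: ler_pM; rewrite ?sqr_ge0//.
      by rewrite ler_sqr ?nnegrE; lra.
    have -> : (2 * (Q + 1)) ^+ 2 * 4 = 16 * (Q + 1) ^+ 2 by ring.
    by rewrite ler_wpM2l// (exprM _ 2 2) ler_eXnr// exprn_ege1// lerDr.
  rewrite coin_meanZ ler_wpM2l//=; apply: le_trans (HC i).
  by apply: coin_mean_le => // s; rewrite -mulrDl addrC subrK mul1r.
Qed.

(** The second moment of this ratio is of order n^-2, by the bound on fourth
    moments. *)
Lemma queue_sqr_cvg0 : {ae P, forall w,
  q n w * (q n w + 1) / n%:R @[n --> \oo] --> (0 : R)}.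
Proof.
have [C HC] := @qlen_pow4_bounded R alpha q0 a0 a2.
have a01 : 0 <= alpha <= 1 by have := a0; have := a2 => *; apply/andP; split; lra.
pose F k (s : seq bool) : R := ((qlen q0 s)%:R * ((qlen q0 s)%:R + 1) / k.+1%:R) ^+ 2.
have : {ae P, forall w, F k (history b k.+1 w) @[k --> \oo] --> (0 : R)}.
  apply: (@ae_cvg0 _ _ _ P _ C).
  - by move=> k w; exact: sqr_ge0.
  - by move=> k; exact: (integrable_history P mb k.+1 (F k)).
  move=> k; rewrite (mean_history mb Pb).
  apply: (@le_trans _ _ (coin_mean alpha k.+1 (fun s => k.+1%:R ^- 2 * ((qlen q0 s)%:R + 1) ^+ 4))).
    apply: coin_mean_le => // s; rewrite /F exprMn exprVn mulrC ler_wpM2l ?invr_ge0 ?exprn_ge0//.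
    rewrite (exprM _ 2 2) ler_sqr ?nnegrE ?sqr_ge0 ?mulr_ge0 ?addr_ge0//.
    by rewrite expr2 ler_wpM2r ?addr_ge0// lerDl.
  by rewrite coin_meanZ mulrC ler_wpM2r ?invr_ge0 ?exprn_ge0.
apply: filterS => w Fw; rewrite -(cvg_shiftS (fun n => q n w * (q n w + 1) / n%:R)).
apply/cvgr0Pnorm_le => e e0.
have e2 : 0 < e ^+ 2 by rewrite exprn_gt0.
near=> k.
have h : `|F k (history b k.+1 w)| <= e ^+ 2.
  by near: k; exact: cvgr0_norm_le.
rewrite /F normrX in h; rewrite -ler_sqr ?nnegrE//.
exact: ltW.
Unshelve. all: by end_near. Qed.

(** Summing [qlen_identity] and solving for the sum of q - eta leaves only the
    centred increments and boundary terms; eta is the value for which the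
    constant terms cancel. *)
Lemma queue_average (eta : R) : eta = alpha / (1 - 2 * alpha) ->
  {ae P, forall w,
    n%:R^-1 * (\sum_(0 <= k < n) (q k.+1 w - eta)) @[n --> \oo] --> (0 : R)}.
Proof.
move=> etaE; have := queue_increment_slln; have := queue_sqr_cvg0.
apply: filterS2 => w Sw Nw.
have m0 : 1 - 2 * alpha != 0 by have := a2 => ?; rewrite gt_eqF//; lra.
have ni : n%:R^-1 @[n --> \oo] --> (0 : R) 
  by rewrite -(cvg_shiftS (fun n => n%:R^-1 : R)); exact: cvg_harmonic.
(* The summed identity, with eta chosen so that no term linear in n remains. *)
have tele n : q n w * (q n w + 1) = q0%:R * (q0%:R + 1) +
    \sum_(0 <= i < n) queue_increment (history b i.+1 w) -
    2 * (1 - 2 * alpha) * \sum_(0 <= k < n) (q k w - eta).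
  elim: n => [|n IH]; first by rewrite !big_geq// mulr0 subr0 addr0.
  rewrite !big_nat_recr//= historyS (qlen_identity q0) IH /= etaE; field.
  by [].
have shift n : \sum_(0 <= k < n) (q k.+1 w - eta) =
    \sum_(0 <= k < n) (q k w - eta) + q n w - q0%:R.
  elim: n => [|n IH]; first by rewrite !big_geq// add0r subrr.
  by rewrite !big_nat_recr//= IH; ring.
have qw : q n w / n%:R @[n --> \oo] --> (0 : R).
  apply: (squeeze_cvgr _ (cvg_cst 0) Sw); near=> n; apply/andP; split.
    by rewrite divr_ge0.
  by rewrite ler_wpM2r ?invr_ge0// ler_peMr// lerDr.
rewrite [X in X @ _](_ : _ = fun n => (2 * (1 - 2 * alpha))^-1 *
   (n%:R^-1 * (q0%:R * (q0%:R + 1)) + n%:R^-1 *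
      \sum_(0 <= i < n) queue_increment (history b i.+1 w) - q n w * (q n w + 1) / n%:R)
   + (q n w / n%:R - n%:R^-1 * q0%:R)); last first.
  apply/funext => n; rewrite shift.
  have -> : \sum_(0 <= k < n) (q k w - eta) = (2 * (1 - 2 * alpha))^-1 *
    (q0%:R * (q0%:R + 1) +
    \sum_(0 <= i < n) queue_increment (history b i.+1 w) - q n w * (q n w + 1)).
    by rewrite tele; field.
  ring.
have E0 : (2 * (1 - 2 * alpha))^-1 *
   (0 * (q0%:R * (q0%:R + 1)) + 0 - 0) + (0 - 0 * q0%:R) = 0 :> R by ring.
rewrite -[X in _ --> X]E0.
have nc (c : R) : n%:R^-1 * c @[n --> \oo] --> 0 * c.
  by apply: cvgM; [exact: ni|exact: cvg_cst].
apply: cvgD.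
  apply: cvgM; first exact: cvg_cst.
  apply: cvgB; last exact: Sw.
  by apply: cvgD; [exact: nc|exact: Nw].
by apply: cvgB; [exact: qw|exact: nc].
Unshelve. all: by end_near. Qed.

End queue_average.

(** * Symmetry of the normal law *)

Section normal_law.
Context {R : realType}.
Local Notation leb := (@lebesgue_measure R).

(** The normal law is defined through its density, so the Radon-Nikodym derivative
    is that density almost everywhere. *)
Lemma ge0_integral_normal_prob (f : R -> \bar R) :
  measurable_fun [set: R] f -> (forall x, (0 <= f x)%E) ->
  (\int[normal_prob 0 1]_x f x = \int[leb]_x (f x * (normal_pdf 0 1 x)%:E))%E.
Proof.
move=> mf f0.
have dom := @normal_prob_dominates R 0 1.
rewrite -(Radon_Nikodym_SigmaFinite.change_of_variables dom)//.
have mg : measurable_fun [set: R]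
    (Radon_Nikodym_SigmaFinite.f (normal_prob (0 : R) 1) leb).
  by apply: (measurable_int leb); exact: Radon_Nikodym_SigmaFinite.f_integrable.
have mp : measurable_fun [set: R] (fun x => (normal_pdf 0 1 x)%:E : \bar R).
  by apply/measurable_EFinP; exact: measurable_normal_pdf.
apply: ae_eq_integral => //.
- exact: emeasurable_funM.
- exact: emeasurable_funM.
apply: ae_eqe_mul2l; apply: integral_ae_eq => //.
  exact: Radon_Nikodym_SigmaFinite.f_integrable.
by move=> E _ mE; rewrite -Radon_Nikodym_SigmaFinite.f_integral.
Qed.

(** The bound x^2 <= 3 exp (3 x^2 / 8) turns the second moment into a multiple of
    the total mass of the normal law of standard deviation 2. *)
Lemma normal_prob_sqr_lty : (\int[normal_prob 0 1]_x ((x ^+ 2)%:E : \bar R) < +oo)%E.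
Proof.
rewrite ge0_integral_normal_prob; last by move=> x; rewrite lee_fin sqr_ge0.
  pose K : R := 3 * (normal_peak 1 / normal_peak 2).
  apply: (@le_lt_trans _ _ (\int[leb]_x (K%:E * (normal_pdf 0 2 x)%:E))%E).
    apply: ge0_le_integral => //.
    - by move=> x _; rewrite mule_ge0// lee_fin ?sqr_ge0// normal_pdf_ge0.
    - apply/measurable_EFinP; apply: measurable_funM; first exact: measurable_funX.
      exact: measurable_normal_pdf.
    - apply/measurable_EFinP; apply: measurable_funM => //.
      exact: measurable_normal_pdf.
    move=> x _; rewrite -!EFinM lee_fin !normal_pdfE ?oner_eq0//.
    have p0 : 0 < normal_peak (2 : R) by exact: normal_peak_gt0.
    have -> : K * (normal_peak 2 * normal_fun 0 2 x) =
       normal_peak 1 * (3 * normal_fun 0 2 x).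
      by rewrite /K; field; rewrite gt_eqF.
    rewrite mulrCA ler_wpM2l ?normal_peak_ge0// /normal_fun subr0.
    have -> : - x ^+ 2 / (1 ^+ 2 *+ 2) = - (3 / 8 * x ^+ 2) + - x ^+ 2 / (2 ^+ 2 *+ 2) :> R.
      by rewrite -mulr_natl; field.
    rewrite expRD mulrA ler_wpM2r ?expR_ge0// expRN ler_pdivrMr ?expR_gt0//.
    have := expR_ge1Dx (3 / 8 * x ^+ 2); have := sqr_ge0 x; lra.
  rewrite integralZl//; last exact: integrable_normal_pdf.
  by rewrite integral_normal_pdf mule1 ltry.
by apply/measurable_EFinP; exact: measurable_funX.
Qed.

Lemma normal_prob_opp (B : set R) : measurable B ->
  normal_prob 0 1 (-%R @^-1` B) = normal_prob 0 1 B :> \bar R.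
Proof.
move=> mB; rewrite /normal_prob.
transitivity (\int[leb]_(x in -%R @^-1` B) (normal_pdf 0 1 (- x))%:E)%E.
  apply: eq_integral => x _; rewrite !normal_pdfE ?oner_eq0//.
  by rewrite /normal_fun !subr0 sqrrN.
have mopp : measurable_fun [set: measurableTypeR R] (-%R : measurableTypeR R -> measurableTypeR R).
  exact: oppr_measurable.
rewrite -(ge0_integral_pushforward mopp leb (D := B) (f := fun x => (normal_pdf 0 1 x)%:E))//.
- by apply: eq_measure_integral => A mA _; exact: lebesgue_measureN.
- by apply/measurable_funTS/measurable_EFinP; exact: measurable_normal_pdf.
- by move=> x _; rewrite lee_fin normal_pdf_ge0.
Qed.

End normal_law.

Section symmetric.
Context {d : measure_display} {T : measurableType d} {R : realType}.
Variable P : probability T R.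

Lemma measurable_pair_rv (X Y : {RV P >-> R}) :
  measurable_fun [set: T] (fun w => (X w, Y w)).
Proof. exact: measurable_fun_pair. Qed.

Definition pair_rv (X Y : {RV P >-> R}) : {RV P >-> (R * R)%type} :=
  HB.pack (fun w => (X w, Y w))
    (isMeasurableFun.Build _ _ _ _ _ (measurable_pair_rv X Y)).

(** Both joint laws agree with the product measure on rectangles, hence on every
    measurable set. *)
Lemma joint_law_unique (X Y X' Y' : {RV P >-> R}) :
  (forall A B, measurable A -> measurable B ->
     P (X @^-1` A `&` Y @^-1` B) = (P (X @^-1` A) * P (Y @^-1` B))%E) ->
  (forall A B, measurable A -> measurable B ->
     P (X' @^-1` A `&` Y' @^-1` B) = (P (X @^-1` A) * P (Y @^-1` B))%E) ->
  forall C : set (R * R), measurable C ->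
    distribution P (pair_rv X Y) C = distribution P (pair_rv X' Y') C.
Proof.
move=> XY XY'.
suff main (U V : {RV P >-> R}) :
    (forall A B, measurable A -> measurable B ->
     P (U @^-1` A `&` V @^-1` B) = (P (X @^-1` A) * P (Y @^-1` B))%E) ->
    forall C : set (R * R), measurable C ->
    (distribution P X \x distribution P Y)%E C = distribution P (pair_rv U V) C.
  by move=> C mC; rewrite -!main.
move=> UV C mC.
exact: product_measure_unique.
Qed.

(** For independent [X] and [Y] with [Y] symmetric, the pairs (X, Y) and (X, - Y)
    have the same law, so the mean of the product equals its own opposite.  This
    avoids a product formula for means and the computation of the mean of [Y]. *)
Lemma dot_symmetric (X Y : {RV P >-> R}) :
  (X : T -> R) \in Lfun P 2%:E -> (Y : T -> R) \in Lfun P 2%:E ->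
  (forall A B, measurable A -> measurable B ->
     P (X @^-1` A `&` Y @^-1` B) = (P (X @^-1` A) * P (Y @^-1` B))%E) ->
  (forall B : set R, measurable B -> P (Y @^-1` (-%R @^-1` B)) = P (Y @^-1` B)) ->
  dot P X Y = 0.
Proof.
move=> lX lY XY Ysym.
have mYN : measurable_fun [set: T] (fun w => - Y w) by exact: measurableT_comp.
pose mixin := isMeasurableFun.Build _ _ _ _ _ mYN.
pose Y' : {mfun T >-> R} := HB.pack (fun w => - Y w) mixin.
have law : forall C : set (R * R), measurable C ->
    distribution P (pair_rv X Y) C = distribution P (pair_rv X Y') C.
  apply: joint_law_unique => // A B mA mB.
  rewrite -[Y' @^-1` B]/(Y @^-1` (-%R @^-1` B)) XY//; first by rewrite Ysym.
  by rewrite -[X in measurable X]setTI; apply: oppr_measurable.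
have int2 (V : {RV P >-> R}) : (V : T -> R) \in Lfun P 2%:E ->
    (\int[distribution P (pair_rv X V)]_z (z.1 * z.2)%:E = (dot P X V)%:E)%E.
  move=> lV; have iXV := L2M lX lV.
  rewrite integral_distribution//=.
    by rewrite /dot /Rintegral fineK//; exact: integrable_fin_num iXV.
  by apply/measurable_EFinP; apply: measurable_funM.
have lY' : (Y' : T -> R) \in Lfun P 2%:E.
  have -> : (Y' : T -> R) = (fun w => (-1) * Y w) by apply/funext => w; rewrite mulN1r.
  exact: L2Z.
have : (dot P X Y)%:E = (dot P X Y')%:E.
  rewrite -(int2 Y lY) -(int2 Y' lY'). apply: eq_measure_integral => A mA _; exact: law.
have -> : dot P X Y' = - dot P X Y.
  have -> : (Y' : T -> R) = (fun w => (-1) * Y w) by apply/funext => w; rewrite mulN1r.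
  by rewrite dotC dotZl// mulN1r dotC.
by move=> [] ?; lra.
Qed.

End symmetric.

(** * Integration over an independent event *)

Section independent_event.
Context {d : measure_display} {T : measurableType d} {R : realType}.
Variable P : probability T R.

(** The restriction of [P] to [A], pushed forward by [X], is the law of [X] scaled
    by the probability of [A]. *)
Lemma integral_independent_event (A : set T) (X : {RV P >-> R}) (f : R -> \bar R) :
  measurable A ->
  (forall B, measurable B -> P (A `&` X @^-1` B) = (P A * P (X @^-1` B))%E) ->
  measurable_fun [set: R] f -> (forall x, (0 <= f x)%E) ->
  (\int[P]_(w in A) f (X w) = P A * \int[P]_w f (X w))%E.
Proof.
move=> mA AX mf f0.
have mfX : measurable_fun [set: T] (fun w => f (X w)) by exact: measurableT_comp.
pose PA := mrestr P mA.
transitivity (\int[PA]_(w in A) f (X w))%E.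
  apply: eq_measure_integral => B mB BA.
  by rewrite /PA/= /mrestr setIidl.
transitivity (\int[PA]_w f (X w))%E.
  rewrite -[in RHS](setUv A) ge0_integral_setU//; last 3 first.
  - exact: measurableC.
  - by rewrite setUv.
  - exact/disj_setPCl.
  rewrite [X in (_ + X)%E](_ : _ = 0%E) ?adde0//.
  apply: null_set_integral => //; first exact: measurableC.
    exact: measurable_funTS.
  by rewrite /PA/= /mrestr setICl measure0.
have PA0 : 0 <= fine (P A) by rewrite fine_ge0.
pose k : {nonneg R} := NngNum PA0.
have kE : k%:num%:E = P A by rewrite /= fineK// fin_num_measure.
rewrite -(ge0_integral_distribution X)// -kE.
rewrite -(ge0_integral_mscale (distribution P X) measurableT k)//.
rewrite -[LHS](ge0_integral_pushforward (phi := X) _ PA measurableT)//.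
apply: eq_measure_integral => B mB _.
by rewrite /PA/= /mscale /pushforward /mrestr/= setIC AX// fineK// fin_num_measure.
Qed.

End independent_event.

(** * Gaussian white noise and linear recursions driven by it *)

Section gaussian_noise.
Context {d : measure_display} {T : measurableType d} {R : realType}.
Variable P : probability T R.
Variable V : nat -> {RV P >-> R}.
Hypothesis V_indep : mutually_independent V.
Hypothesis V_normal : forall n (B : set R), measurable B ->
  distribution P (V n) B = normal_prob 0 1 B.

Local Notation NP := (normal_prob (0 : R)%R (1 : R)%R).

Definition normal_var : R := fine (\int[normal_prob 0 1]_x ((x ^+ 2)%:E : \bar R))%E.

Lemma normal_prob_sqrE : (\int[normal_prob 0 1]_x ((x ^+ 2)%:E : \bar R) = normal_var%:E)%E.
Proof.
rewrite /normal_var fineK// ge0_fin_numE ?normal_prob_sqr_lty//.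
by apply: integral_ge0 => x _; rewrite lee_fin sqr_ge0.
Qed.

(** Otherwise the normal law would sit at 0, but it has a density. *)
Lemma normal_var_gt0 : 0 < normal_var.
Proof.
have v0 : 0 <= normal_var.
  by rewrite -lee_fin -normal_prob_sqrE; apply: integral_ge0 => x _; rewrite lee_fin sqr_ge0.
rewrite lt_neqAle v0 andbT eq_sym; apply/eqP => v_eq0.
have := normal_prob_sqrE; rewrite v_eq0 => I0.
have mx : measurable_fun [set: R] (fun x => (x ^+ 2)%:E : \bar R).
  by apply/measurable_EFinP; exact: measurable_funX.
have [N [mN N0 subN]] : ae_eq (normal_prob 0 1) [set: R] (fun x => (x ^+ 2)%:E : \bar R) (cst 0%E).
  apply/(ae_eq_integral_abs (normal_prob (0 : R) 1) measurableT mx).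
  rewrite -[RHS]I0; apply: eq_integral => x _.
  by rewrite gee0_abs// lee_fin sqr_ge0.
have z0 : normal_prob 0 1 [set (0 : R)] = 0%E.
  have /null_content_dominatesP := @normal_prob_dominates R 0 1; apply => //.
  exact: lebesgue_measure_set1.
have : (NP [set: R] <= NP N + NP [set (0 : R)%R])%E.
  apply: le_trans (measureU2 _ mN _) => //.
  apply: le_measure; rewrite ?inE//; first exact: measurableU.
  move=> x _; have [->|x0] := eqVneq x 0; first by right.
  left; apply: subN => /= /(_ I) [] /eqP.
  by rewrite expf_eq0 (negbTE x0).
by rewrite probability_setT N0 z0 adde0 leNgt lte01.
Qed.

Lemma integral_noise_sqr n : (\int[P]_w ((V n w ^+ 2)%:E) = normal_var%:E)%E.
Proof.
rewrite -normal_prob_sqrE.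
(* The normal law lives on [measurableTypeR R], whose measurable sets are those
   of [R] but under another display; hence the change of codomain of [V n]. *)
have mV : measurable_fun [set: T] (V n : T -> measurableTypeR R).
  exact: (@measurable_funP _ _ _ _ setT (V n)).
pose Vm : {mfun T >-> measurableTypeR R} :=
  HB.pack (V n : T -> measurableTypeR R) (isMeasurableFun.Build _ _ _ _ _ mV).
transitivity (\int[distribution P Vm]_x ((x ^+ 2)%:E : \bar R))%E.
  rewrite ge0_integral_distribution//; last by move=> x; rewrite lee_fin sqr_ge0.
  by apply/measurable_EFinP; exact: measurable_funX.
by apply: eq_measure_integral => B mB _; exact: V_normal.
Qed.

Lemma noise_L2 n : (V n : T -> R) \in Lfun P 2%:E.
Proof.
apply: L2_of_sqr => //; apply/integrableP; split.
  by apply/measurable_EFinP; exact: measurable_funX.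
under eq_integral do rewrite gee0_abs ?lee_fin ?sqr_ge0//.
by rewrite integral_noise_sqr ltry.
Qed.

Lemma noise_var n : dot P (V n) (V n) = normal_var.
Proof.
rewrite /dot /Rintegral; under eq_integral do rewrite -expr2.
by rewrite integral_noise_sqr.
Qed.

Lemma noise_opp n (B : set R) : measurable B ->
  P (V n @^-1` (-%R @^-1` B)) = P (V n @^-1` B).
Proof.
move=> mB; rewrite -[LHS]/(distribution P (V n) (-%R @^-1` B)).
rewrite -[RHS]/(distribution P (V n) B) !V_normal//; first exact: normal_prob_opp.
by rewrite -[X in measurable X]setTI; exact: oppr_measurable.
Qed.

Lemma noise_uncorrelated i j : i != j -> dot P (V i) (V j) = 0.
Proof.
move=> ij; apply: dot_symmetric; rewrite ?noise_L2//; last exact: noise_opp.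
move=> A B mA mB.
have ji : (j == i) = false by rewrite eq_sym; exact/negbTE.
have := @V_indep [:: i; j] (fun k => if k == i then A else B).
rewrite /= inE ij => /(_ isT) VAB.
transitivity (\prod_(k <- [:: i; j]) P (V k @^-1` (if k == i then A else B)))%E.
  rewrite -VAB; last by move=> k _; case: ifP.
  congr (P _); apply/seteqP; split => w /=.
    by move=> [Aw Bw] k /=; rewrite !inE => /orP[] /eqP ->; rewrite ?eqxx ?ji.
  move=> h; have := h i; have := h j.
  by rewrite /= !inE !eqxx orbT ji => /(_ isT) ? /(_ isT) ?.
by rewrite big_cons big_seq1 eqxx ji.
Qed.

Lemma noise_mean0 (c : R) n : dot P (fun=> c) (V n) = 0.
Proof.
pose X : {RV P >-> R} := cst c.
apply: (@dot_symmetric _ _ _ P X); rewrite ?noise_L2 ?L2_cst//; last exact: noise_opp.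
move=> A B mA mB; rewrite preimage_cst; case: ifPn => _.
  by rewrite setTI probability_setT mul1e.
by rewrite set0I measure0 mul0e.
Qed.

Variables (g a : nat -> R) (x0 : R).

Fixpoint driven (n : nat) (w : T) : R :=
  if n is k.+1 then g k * driven k w + a k * V k w else x0.

Lemma driven_L2 n : driven n \in Lfun P 2%:E.
Proof.
elim: n => [|n IH]; first exact: L2_cst.
by apply: L2D; apply: L2Z => //; exact: noise_L2.
Qed.

(** The state at time n is a combination of the noise variables of index below n. *)
Lemma driven_uncorrelated n m : (n <= m)%N -> dot P (driven n) (V m) = 0.
Proof.
elim: n => [|n IH] nm; first exact: noise_mean0.
have [[lx lV] lm] := (driven_L2 n, noise_L2 n, noise_L2 m).
rewrite /= dotDl ?L2Z// !dotZl// IH ?mulr0 ?add0r; last exact: ltnW.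
by rewrite noise_uncorrelated ?mulr0// ltn_eqF.
Qed.

Lemma driven_sqrS n : dot P (driven n.+1) (driven n.+1) =
  g n ^+ 2 * dot P (driven n) (driven n) + a n ^+ 2 * normal_var.
Proof.
have [lx lV] := (driven_L2 n, noise_L2 n).
rewrite /= dot_sqrD ?L2Z// !dotZl ?L2Z//.
rewrite ![dot P _ (fun _ => _ * _)]dotC !dotZl// [dot P (V n) _]dotC.
by rewrite driven_uncorrelated// noise_var; ring.
Qed.

Lemma driven_sigma n (B : set R) : measurable B -> sigma_process V (driven n @^-1` B).
Proof.
move=> mB; pose G := \bigcup_n preimage_set_system setT (V n) measurable.
pose T' := g_sigma_algebraType G.
have mV k : measurable_fun [set: T'] (V k : T' -> R).
  move=> _ C mC; apply: sub_sigma_algebra; exists k => //; exists C => //.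
have mdriven : measurable_fun [set: T'] (driven n : T' -> R).
  elim: n => [|n IH] /=; first exact: measurable_cst.
  by apply: measurable_funD; apply: measurable_funM => //; exact: measurable_cst.
by have := mdriven measurableT B mB; rewrite setTI.
Qed.

End gaussian_noise.

(** * From steps to coins *)

Section steps.
Context {d : measure_display} {T : measurableType d} {R : realType}.
Variable P : probability T R.

Definition up (D : nat -> {RV P >-> R}) (n : nat) (w : T) : bool := D n w == 1.

Lemma measurable_up (D : nat -> {RV P >-> R}) n : measurable [set w | up D n w].
Proof.
rewrite (_ : [set _ | _] = D n @^-1` [set 1]).
  by rewrite -[X in measurable X]setTI; exact: measurable_funP.
by apply/seteqP; split => w /eqP.
Qed.

(** Only the event that a step equals 1 enters, so no value of the step has to be
    discarded; that steps are - 1 otherwise holds almost surely ([steps_ae]). *)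
Lemma history_law (D : nat -> {RV P >-> R}) (alpha : R) :
  mutually_independent D -> (forall n, P [set w | D n w = 1] = alpha%:E) ->
  forall s, P [set w | history (up D) (size s) w = s] = (weight alpha s)%:E.
Proof.
move=> D_indep D_up s.
pose t := rev s; pose F x : set R := if x then [set 1] else ~` [set 1].
have PF n x : P (D n @^-1` F x) = (if x then alpha else 1 - alpha)%:E.
  case: x; first exact: D_up.
  rewrite /F -preimage_setC probability_setC; last first.
    by rewrite -[X in measurable X]setTI; exact: measurable_funP.
  by rewrite [P _](D_up n) EFinB.
transitivity (\prod_(i <- iota 0 (size s)) P (D i @^-1` F (nth false t i)))%E.
  rewrite -D_indep ?iota_uniq//; last first.
    by move=> i _; rewrite /F; case: ifP => _ //; exact: measurableC.
  congr (P _); apply/seteqP; split => w /=.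
    move=> ws i /=; rewrite mem_iota/= add0n => iw.
    rewrite /t -ws revK nth_mkseq// /up.
    by rewrite /F; case: ifPn => /eqP.
  move=> h; rewrite /history -[RHS]revK; congr rev.
  apply: (@eq_from_nth _ false); rewrite size_mkseq ?size_rev// => i iw.
  rewrite nth_mkseq//; have := h i; rewrite /= mem_iota/= add0n iw => /(_ isT).
  by rewrite /F -/t /up; case: (nth false t i) => /= [->|/eqP/negbTE ->]; rewrite ?eqxx.
under eq_bigr do rewrite PF.
rewrite prodEFin; congr EFin.
have -> : weight alpha s = \prod_(x <- t) (if x then alpha else 1 - alpha).
  by apply: perm_big; rewrite perm_sym perm_rev.
rewrite (big_nth false) size_rev.
by rewrite /index_iota subn0.
Qed.

Lemma queue_path (D Q : nat -> T -> R) (q0 : nat) w :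
  Q 0%N w = q0%:R -> (forall n, Q n.+1 w = Num.max 0 (Q n w + D n w)) ->
  (forall n, D n w = 1 \/ D n w = -1) ->
  forall n, Q n w = (qlen q0 (history (fun n w => D n w == 1) n w))%:R.
Proof.
move=> Q0 QS Dpm; elim=> [|n IH]; first by rewrite Q0.
rewrite historyS /= QS IH; set q := qlen _ _.
case: (Dpm n) => -> /=.
  by rewrite eqxx natr1; apply/max_idPr.
rewrite [_ == 1](_ : _ = false); last by apply/eqP; lra.
case: q => [|q] /=; first by rewrite add0r; apply/max_idPl; lra.
by rewrite -natr1 addrK; apply/max_idPr.
Qed.

Lemma steps_ae (D : nat -> {RV P >-> R}) (alpha mu : R) : alpha + mu = 1 ->
  (forall n, P [set w | D n w = 1] = alpha%:E) ->
  (forall n, P [set w | D n w = -1] = mu%:E) ->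
  {ae P, forall w, forall n, D n w = 1 \/ D n w = -1}.
Proof.
move=> am D_up D_down; apply/ae_foralln => n.
have mD c : measurable [set w | D n w = c].
  by rewrite -[X in measurable X]setTI; exact: (measurable_funP (D n) measurableT [set c]).
pose U := [set w | D n w = 1] `|` [set w | D n w = -1].
have mU : measurable U by exact: measurableU.
have PU : P (~` U) = 0%E.
  rewrite probability_setC// measureU//; last first.
    by apply/seteqP; split => // w [/= -> ?]; lra.
  by rewrite [X in (_ - (X + _))%E]D_up [X in (_ - (_ + X))%E]D_down -EFinD am subrr.
by exists (~` U); split => //; exact: measurableC.
Qed.

End steps.

(** * Almost sure convergence *)

Section almost_sure.
Context {d : measure_display} {T : measurableType d} {R : realType}.
Variable P : probability T R.

Lemma recursion_ae_cvg0 (alpha eta : R) (q0 : nat)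
  (D V Q theta : nat -> {RV P >-> R}) :
  0 < alpha -> alpha < 2^-1 -> eta = alpha / (1 - 2 * alpha) ->
  mutually_independent D ->
  (forall n, P [set w | D n w = 1] = alpha%:E) ->
  (forall n, P [set w | D n w = -1] = (1 - alpha)%:E) ->
  (forall w, Q 0%N w = q0%:R) ->
  (forall n w, Q n.+1 w = Num.max 0 (Q n w + D n w)) ->
  mutually_independent V ->
  (forall n (B : set R), measurable B ->
     distribution P (V n) B = normal_prob 0 1 B) ->
  (forall n w, theta n.+1 w = theta n w +
     (n.+1%:R)^-1 * ((Q n.+1 w - eta - 1) * theta n w + V n w)) ->
  {ae P, forall w, theta n w @[n --> \oo] --> (0 : R)}.
Proof.
move=> a0 a2 etaE D_indep D_up D_down Q0 QS V_indep V_normal thetaS.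
have am : alpha + (1 - alpha) = 1 by ring.
have eta0 : 0 <= eta by rewrite etaE divr_ge0//; lra.
have qavg := queue_average q0 a0 a2 (measurable_up D)
  (history_law D_indep D_up) etaE.
have savg : {ae P, forall w,
    n%:R^-1 * (\sum_(0 <= i < n) V i w) @[n --> \oo] --> (0 : R)}.
  apply: (@slln_uncorrelated _ _ _ P (fun i w => V i w) normal_var).
  - by move=> i; exact: noise_L2.
  - by move=> i j /ltn_eqF/negbT; exact: noise_uncorrelated.
  - by move=> i; rewrite noise_var.
apply: filterS3 (steps_ae am D_up D_down) qavg savg => w Dpm cw sw.
have Qq := @queue_path _ _ _ (fun n => D n) (fun n => Q n) q0 w (Q0 w) (fun n => QS n w) Dpm.
(* At n = 0 both averages are 0, the inverse of 0 being 0. *)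
pose s n : R := n%:R^-1 * \sum_(0 <= i < n) V i w.
pose c n : R := n%:R^-1 * \sum_(0 <= k < n) (Q k.+1 w - eta).
have nK n (u : R) : n.+1%:R * (n.+1%:R^-1 * u) = u by rewrite mulVKf.
have sS n : s n.+1 = s n + n.+1%:R^-1 * (V n w - s n).
  rewrite {1}/s big_nat_recr//=.
  have -> : \sum_(0 <= i < n) V i w = n%:R * s n.
    by case: n => [|n]; [rewrite big_geq// mul0r|rewrite /s nK].
  by rewrite -natr1; field; rewrite natr1.
have c0 : c n @[n --> \oo] --> (0 : R).
  rewrite [X in X @ _](_ : _ = fun n => n%:R^-1 * \sum_(0 <= k < n)
    ((qlen q0 (history (up D) k.+1 w))%:R - eta)); first exact: cw.
  by apply/funext => n; rewrite /c; congr (_ * _); apply: eq_bigr => k _; rewrite Qq.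
have y0 : (theta n w - s n) @[n --> \oo] --> (0 : R).
  apply: (@recursion_cvg0 _ eta (fun n => Q n w) c s) => //.
  - by move=> n; rewrite Qq.
  - move=> n; rewrite {1}/c nK big_nat_recr//=.
    have -> : n%:R * c n = \sum_(0 <= k < n) (Q k.+1 w - eta).
      by case: n => [|n]; [rewrite big_geq// mul0r|rewrite /c nK].
    by rewrite [RHS]addrC addKr.
  - by move=> n; rewrite thetaS sS; ring.
rewrite [X in X @ _](_ : _ = fun n => (theta n w - s n) + s n).
  by rewrite -[X in _ --> X](addr0 0); apply: cvgD; [exact: y0|exact: sw].
by apply/funext => n; rewrite subrK.
Qed.

End almost_sure.

(** * Divergence of the second moment *)

Section growth.
Context {R : realType}.

(** Growth beyond a linear function suffices, through Bernoulli's inequality. *)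
Lemma geometric_growth (r : R) (u : nat -> R) N : 1 < r -> 0 < u N ->
  (forall n, (N <= n)%N -> r * u n <= u n.+1) -> u n @[n --> \oo] --> +oo.
Proof.
move=> r1 uN uS.
have r0 : 0 < r by rewrite (lt_trans _ r1).
have lin k : u N * (k%:R * (r - 1)) <= u (N + k)%N.
  apply: (@le_trans _ _ (u N * r ^+ k)).
    rewrite (ler_wpM2l (ltW uN))//.
    elim: k => [|k IH]; first by rewrite mul0r expr0.
    have rk : 1 <= r ^+ k by rewrite exprn_ege1// ltW.
    rewrite exprS -natr1 mulrDl mul1r.
    have : 0 <= (r - 1) * (r ^+ k - 1) by rewrite mulr_ge0// subr_ge0// ltW.
    lra.
  elim: k => [|k IH]; first by rewrite addn0 expr0 mulr1.
  rewrite addnS; apply: le_trans (uS _ (leq_addr _ _)).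
  by rewrite exprS mulrCA (ler_wpM2l (ltW r0)).
apply/cvgryPge => A.
near=> n.
have Nn : (N <= n)%N by near: n; exact: nbhs_infty_ge.
rewrite -(subnKC Nn); apply: le_trans (lin _).
rewrite -ler_pdivrMl// -ler_pdivrMr ?subr_gt0//.
rewrite natrB// lerBrDr.
near: n; exact: nbhs_infty_ger.
Unshelve. all: by end_near. Qed.

End growth.

Section blowup.
Context {d : measure_display} {T : measurableType d} {R : realType}.
Variable P : probability T R.

Definition climbs (Q : nat -> T -> R) (q0 : nat) (n : nat) : set T :=
  [set w | forall j, (j <= n)%N -> Q j w = (q0 + j)%:R].

(** Needed to apply the independence of the noise from the queue: the event must be
    decided by the queue alone, not by its steps. *)
Lemma climbs_sigma (Q : nat -> {RV P >-> R}) q0 n :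
  sigma_process Q (climbs (fun n => Q n) q0 n).
Proof.
pose G := \bigcup_n preimage_set_system setT (Q n) measurable.
have GQ j : <<s G >> [set w | Q j w = (q0 + j)%:R].
  apply: sub_sigma_algebra; exists j => //; exists [set (q0 + j)%:R] => //.
  by rewrite setTI.
elim: n => [|n IH].
  rewrite (_ : climbs _ _ _ = [set w | Q 0%N w = (q0 + 0)%:R]); first exact: GQ.
  apply/seteqP; split => w /=; first exact.
  by move=> w0 j; rewrite leqn0 => /eqP ->.
rewrite (_ : climbs _ _ _ = climbs (fun n => Q n) q0 n `&` [set w | Q n.+1 w = (q0 + n.+1)%:R]).
  exact: (@measurableI _ (g_sigma_algebraType G) _ _ IH (GQ n.+1)).
apply/seteqP; split => w /=.
  by move=> h; split => [j jn|]; apply: h => //; exact: leqW.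
by move=> [h hn] j; rewrite leq_eqVlt => /predU1P[->//|]; exact: h.
Qed.

Lemma sigma_process_measurable (X : nat -> {RV P >-> R}) A :
  sigma_process X A -> measurable A.
Proof.
apply: smallest_sub; first exact: sigma_algebra_measurable.
by move=> _ [n _ [B mB <-]]; exact: measurable_funP.
Qed.

Lemma climbs_prob (D Q : nat -> {RV P >-> R}) (alpha : R) q0 n :
  mutually_independent D ->
  (forall n, P [set w | D n w = 1] = alpha%:E) ->
  (forall w, Q 0%N w = q0%:R) ->
  (forall n w, Q n.+1 w = Num.max 0 (Q n w + D n w)) ->
  ((alpha ^+ n)%:E <= P (climbs (fun n => Q n) q0 n))%E.
Proof.
move=> D_indep D_up Q0 QS.
have := history_law D_indep D_up (nseq n true); rewrite size_nseq => Ph.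
have -> : alpha ^+ n = weight alpha (nseq n true).
  rewrite /weight; elim: (n) => [|k IH] /=; first by rewrite big_nil expr0.
  by rewrite big_cons -IH exprS.
rewrite -Ph; apply: le_measure; rewrite ?inE.
- exact: (measurable_history (measurable_up D)).
- exact: sigma_process_measurable (climbs_sigma q0 n).
move=> w /= hn; have Dw j : (j < n)%N -> D j w = 1.
  move=> jn; have : nth true (mkseq (up D ^~ w) n) j = true.
    have -> : mkseq (up D ^~ w) n = nseq n true.
      by rewrite -[LHS]revK -/(history _ _ _) hn rev_nseq.
    by rewrite nth_nseq jn.
  by rewrite nth_mkseq// => /eqP.
elim=> [|j IH] jn; first by rewrite addn0.
rewrite QS IH ?(ltnW jn)// Dw// addnS natr1; exact/max_idPr.
Qed.

(** On the event that the queue climbs for n steps, theta is the state [xi] of a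
    linear recursion driven by the noise with deterministic multipliers [g], and
    [xi] is independent of that event.  Even when theta starts at 0, the noise
    makes the second moment of [xi] positive after one step. *)
Lemma second_moment_blowup (alpha eta : R) (q0 : nat) (theta0 : R)
  (D V Q theta : nat -> {RV P >-> R}) :
  3^-1 < alpha ->
  mutually_independent D ->
  (forall n, P [set w | D n w = 1] = alpha%:E) ->
  (forall w, Q 0%N w = q0%:R) ->
  (forall n w, Q n.+1 w = Num.max 0 (Q n w + D n w)) ->
  mutually_independent V ->
  (forall n (B : set R), measurable B ->
     distribution P (V n) B = normal_prob 0 1 B) ->
  independent_processes V Q ->
  (forall w, theta 0%N w = theta0) ->
  (forall n w, theta n.+1 w = theta n w +
     (n.+1%:R)^-1 * ((Q n.+1 w - eta - 1) * theta n w + V n w)) ->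
  ('E_P[fun w => (theta n w ^+ 2)%R])%E @[n --> \oo] --> +oo%E.
Proof.
move=> a3 D_indep D_up Q0 QS V_indep V_normal VQ_indep theta_0 thetaS.
have a0 : 0 < alpha by apply: lt_trans a3; rewrite invr_gt0.
pose g n : R := 1 + n.+1%:R^-1 * ((q0 + n.+1)%:R - eta - 1).
pose a n : R := n.+1%:R^-1.
pose xi := driven V g a theta0.
pose A n := climbs (fun n => Q n) q0 n.
have mA n : measurable (A n) := sigma_process_measurable (climbs_sigma q0 n).
have theta_xi n w : A n w -> theta n w = xi n w.
  elim: n => [|n IH] Aw; first by rewrite theta_0.
  have Qn := Aw n.+1 (leqnn _).
  rewrite thetaS IH; last by move=> j jn; apply: Aw; exact: leqW.
  by rewrite Qn /xi /= /g /a; ring.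
pose x n := dot P (xi n) (xi n).
have x0 n : 0 <= x n by apply: Rintegral_ge0 => w _; rewrite -expr2 sqr_ge0.
have lower n : ((alpha ^+ n * x n)%:E <= 'E_P[fun w => (theta n w ^+ 2)%R])%E.
  rewrite unlock.
  have mth : measurable_fun [set: T] (fun w => (theta n w ^+ 2)%:E : \bar R).
    by apply/measurable_EFinP; exact: measurable_funX.
  apply: le_trans (ge0_subset_integral P (mA n) measurableT mth _ (@subsetT _ _)); last first.
    by move=> w _; rewrite lee_fin sqr_ge0.
  rewrite (_ : (\int[P]_(w in A n) _ = \int[P]_(w in A n) ((xi n w) ^+ 2)%:E)%E); last first.
    by apply: eq_integral => w; rewrite inE => /theta_xi ->.
  have lxi : xi n \in Lfun P 2%:E by exact: driven_L2.
  pose X : {mfun T >-> R} :=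
    HB.pack (xi n) (isMeasurableFun.Build _ _ _ _ _ (L2_measurable lxi)).
  rewrite (@integral_independent_event _ _ _ P (A n) X (fun y => (y ^+ 2)%:E))//; last 3 first.
  - move=> B mB; rewrite setIC VQ_indep//; first by rewrite muleC.
    + exact: driven_sigma.
    + exact: climbs_sigma.
  - by apply/measurable_EFinP; exact: measurable_funX.
  - by move=> y; rewrite lee_fin sqr_ge0.
  have -> : (\int[P]_w ((X w) ^+ 2)%:E = (x n)%:E)%E.
    rewrite /x /dot /Rintegral fineK; last exact: integrable_fin_num (L2M lxi lxi).
    by apply: eq_integral => w _; rewrite -expr2.
  by rewrite EFinM lee_wpmul2r// ?lee_fin//; exact: climbs_prob D_indep D_up Q0 QS.
have xS n : x n.+1 = g n ^+ 2 * x n + a n ^+ 2 * @normal_var R.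
  exact: driven_sqrS.
have v0 := @normal_var_gt0 R.
(* The multipliers tend to 2; 7/4 is enough since (7/4)^2 / 3 > 1. *)
have [N _ HN] : \forall n \near \oo, 7 / 4 <= g n.
  near=> n.
  have -> : g n = 2 + n.+1%:R^-1 * (q0%:R - eta - 1).
    by rewrite /g natrD -natr1; field; rewrite natr1.
  rewrite -lerBlDl.
  have -> : 7 / 4 - 2 = - 4^-1 :> R by field.
  have h4 : n.+1%:R^-1 * `|q0%:R - eta - 1| <= 4^-1.
    rewrite mulrC ler_pdivrMr// -ler_pdivrMl ?invr_gt0// invrK.
    rewrite (@le_trans _ _ n%:R)//; last by rewrite ler_nat.
    near: n; exact: nbhs_infty_ger.
  rewrite (@le_trans _ _ (n.+1%:R^-1 * - `|q0%:R - eta - 1|))//.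
    by rewrite mulrN lerN2.
  by rewrite ler_wpM2l// ?invr_ge0// lerNl -normrN ler_norm.
have : alpha ^+ n * x n @[n --> \oo] --> +oo.
  apply: (@geometric_growth _ (alpha * (7 / 4) ^+ 2) _ N.+1).
  - have -> : (7 / 4) ^+ 2 = 49 / 16 :> R by field.
    by move: a3; lra.
  - have av : 0 < a N ^+ 2 * @normal_var R.
      by rewrite mulr_gt0 ?exprn_gt0 ?invr_gt0.
    apply: mulr_gt0; first exact: exprn_gt0.
    by rewrite xS ltr_wpDl// mulr_ge0// sqr_ge0.
  - move=> n Nn; have gn := HN n (ltnW Nn).
    have -> : alpha * (7 / 4) ^+ 2 * (alpha ^+ n * x n) =
        alpha ^+ n.+1 * ((7 / 4) ^+ 2 * x n) by rewrite [alpha ^+ n.+1]exprS; ring.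
    apply: ler_wpM2l; first by rewrite exprn_ge0// ltW.
    rewrite xS ler_wpDr//; first by rewrite mulr_ge0 ?sqr_ge0// ltW.
    rewrite ler_wpM2r// ler_sqr ?nnegrE//.
    exact: le_trans gn.
move=> /cvgryPge big; apply/cvgeyPge => B.
near=> n; apply: le_trans (lower n); rewrite lee_fin.
by near: n; exact: big.
Unshelve. all: by end_near. Qed.

End blowup.

Theorem proposition4 (R : realType) (d : measure_display)
  (T : measurableType d) (P : probability T R)
  (alpha mu rho eta : R)
  (alpha01 : 0 < alpha < 1)
  (muE : mu = 1 - alpha)
  (rhoE : rho = alpha / mu)
  (rho_lt1 : rho < 1)
  (etaE : eta = rho / (1 - rho))
  (Q0 : nat) (theta0 : R)
  (D W Q theta : nat -> {RV P >-> R})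
  (D_iid : iid (fun n => D n.+1))
  (D_up : forall n, P [set w | D n.+1 w = 1] = alpha%:E)
  (D_down : forall n, P [set w | D n.+1 w = -1] = mu%:E)
  (Q_init : forall w, Q 0%N w = Q0%:R)
  (Q_rec : forall n w, Q n.+1 w = Num.max 0 (Q n w + D n.+1 w))
  (W_iid : iid (fun n => W n.+1))
  (W_normal : forall n (B : set R), measurable B ->
     distribution P (W n.+1) B = normal_prob 0 1 B)
  (W_indep_Q : independent_processes (fun n => W n.+1) Q)
  (theta_init : forall w, theta 0%N w = theta0)
  (theta_rec : forall n w,
     theta n.+1 w =
     theta n w
       + (n.+1%:R)^-1 * ((Q n.+1 w - eta - 1) * theta n w + W n.+1 w)) :
  {ae P, forall w, theta n w @[n --> \oo] --> (0 : R)} /\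
  (1 / 2 < rho ->
     ('E_P[fun w => (theta n w ^+ 2)%R])%E @[n --> \oo] --> +oo%E).
Proof.
have /andP[a0 a1] := alpha01.
have mu0 : 0 < mu by rewrite muE subr_gt0.
have a2 : alpha < 2^-1.
  by move: rho_lt1; rewrite rhoE ltr_pdivrMr// mul1r muE; lra.
have eta_alpha : eta = alpha / (1 - 2 * alpha).
  rewrite etaE rhoE muE; field.
  by apply/andP; split; rewrite gt_eqF//; lra.
have [[D_indep _] [W_indep _]] := (D_iid, W_iid).
split.
  apply: (@recursion_ae_cvg0 _ _ _ P alpha eta Q0 (fun n => D n.+1) (fun n => W n.+1) Q theta) => //.
  by move=> n; rewrite D_down muE.
rewrite rhoE ltr_pdivlMr// muE => rho2.
apply: (@second_moment_blowup _ _ _ P alpha eta Q0 theta0 (fun n => D n.+1) (fun n => W n.+1) Q theta) => //.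
lra.
Qed.
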